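(* The sesqui-linear form $\hat{\mathfrak{t}}$ on $\mathfrak{N}\times\mathfrak{N}$ is an ultra-weak time operator of $h=\frac12(p^2+q^2)$ with symmetric domain $\mathfrak{N}$ and ultra-weak CCR-domain $\mathfrak{N}$.
   Context: Work in $L^2(\mathbb{R})$ with $(f,g)=\int\overline{f}g\,dx$; $q$ is multiplication by $x$, $p=-i\,d/dx$, and $h=\frac12(p^2+q^2)$ is self-adjoint on $D(p^2)\cap D(q^2)$. Let $\mathbb{H}=\{z\in\mathbb C:\operatorname{Im}z>0\}$, $\xi_z(x)=e^{izx^2/2}$ for $z\in\mathbb H$, $\mathscr{C}(z)=\frac{z-i}{z+i}$, and $\log w=\log|w|+i\arg w$ with $-\pi\le\arg w<\pi$. For $z\in\mathbb H\setminus\{i\}$ set $L_0(z)=\log(-\mathscr C(z))$ and, for $k\ge1$, $L_k(z)=\frac{d^{k-1}}{dz^{k-1}}\frac{2i}{1+z^2}$ (the $k$-th $z$-derivative of $\log(-\mathscr C(z))$ where that function is holomorphic). For $n\ge0$ define $[t_z^nL](x,z)=\sum_{k=0}^n\binom nk x^{2(n-k)}(-2i)^kL_k(z)$ (this is $t_z^n$, $t_z=x^2-2i\,\frac{d}{dz}$, applied to $\log(-\mathscr C(z))$), and for a polynomial $\rho(s)=\sum_n c_ns^n$ put $[\rho(t_z)L]=\sum_nc_n[t_z^nL]$. Let $\mathfrak N_0$ be the span of $\{\rho(x^2)\xi_z:\rho$ polynomial, $z\in\mathbb H\setminus\{i\}\}$, $\mathfrak N_1$ the span of $\{\rho(x^2)x\xi_z\}$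 (same ranges), $\mathfrak N=\mathfrak N_0\oplus\mathfrak N_1$. Define linear operators $\hat S$ on $\mathfrak N_0$ and $\hat S^*$ on $\mathfrak N_1$ (notation only) by $\hat S(\rho(x^2)\xi_z)=\frac i2[\rho(t_z)L](x,z)\,\xi_z$ and $\hat S^*(\rho(x^2)x\xi_z)=\frac i2[\rho(t_z)L](x,z)\,x\xi_z$, extended linearly. Define $\hat{\mathfrak t}_0[\psi,\phi]=\frac12((\hat S\psi,\phi)+(\psi,\hat S\phi))$ on $\mathfrak N_0$, $\hat{\mathfrak t}_1[\psi,\phi]=\frac12((\hat S^*\psi,\phi)+(\psi,\hat S^*\phi))$ on $\mathfrak N_1$, and $\hat{\mathfrak t}[\psi_0\oplus\psi_1,\phi_0\oplus\phi_1]=\hat{\mathfrak t}_0[\psi_0,\phi_0]+\hat{\mathfrak t}_1[\psi_1,\phi_1]$. Definition (ultra-weak time operator): for $H$ self-adjoint on $\mathcal H$ and nonzero subspaces $D_1,D_2$, a sesqui-linear form $\mathfrak t:D_1\times D_2\to\mathbb C$ is an ultra-weak time operator of $H$ with symmetric domain $D$ and ultra-weak CCR-domain $E$ ($D,E$ nonzero subspaces of $D_1\cap D_2$) if (1) $E\subset D(H)\cap D$; (2) $\overline{\mathfrak t[\phi,\psi]}=\mathfrak t[\psi,\phi]$ for $\phi,\psi\in D$; (3) $HE\subset D_1$ and $\mathfrak t[H\phi,\psi]-\overline{\mathfrak t[H\psi,\phi]}=-i(\phi,\psi)$ for $\phi,\psi\in E$. *)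

(* Defs.v *)
From Stdlib Require Import Reals List ClassicalEpsilon.
From Coquelicot Require Import Coquelicot.
Set Implicit Arguments.

Open Scope R_scope.

Definition Cexp (z : C) : C :=
  (exp (Re z) * cos (Im z), exp (Re z) * sin (Im z)).

(* arg w : the (unique, for w <> 0) theta with -pi <= theta < pi and
   w = |w| e^{i theta} *)
Definition Carg (w : C) : R :=
  epsilon (inhabits 0%R)
    (fun th => -PI <= th < PI /\ w = (Cmod w * cos th, Cmod w * sin th)).

Definition Clog (w : C) : C := (ln (Cmod w), Carg w).

Definition Cayley (z : C) : C := Cdiv (Cminus z Ci) (Cplus z Ci).

Definition cderiv (f : C -> C) (z : C) : C :=
  epsilon (inhabits (RtoC 0))
    (fun l => is_derive (K := C_AbsRing) (V := C_NormedModule) f z l).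

Definition L0 (z : C) : C := Clog (Copp (Cayley z)).

Definition Lgen (w : C) : C :=
  Cdiv (Cmult (RtoC 2) Ci) (Cplus (RtoC 1) (Cmult w w)).

Definition Lk (k : nat) (z : C) : C :=
  match k with
  | O => L0 z
  | S m => Nat.iter m cderiv Lgen z
  end.

Definition Csum (l : list C) : C := fold_right Cplus (RtoC 0) l.

Definition tL (n : nat) (x : R) (z : C) : C :=
  Csum (map (fun k =>
     Cmult (Cmult (RtoC (Binomial.C n k * x ^ (2 * (n - k))))
                  (Cpow (Cmult (RtoC (-2)) Ci) k))
           (Lk k z))
     (seq 0 (S n))).

(* a polynomial rho(s) = sum_n c_n s^n is given by its coefficient list *)
Definition poly := list C.

Definition poly_eval_sq (rho : poly) (x : R) : C :=
  Csum (map (fun n => Cmult (nth n rho (RtoC 0)) (RtoC ((x ^ 2) ^ n)))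
            (seq 0 (length rho))).

Definition rhoL (rho : poly) (x : R) (z : C) : C :=
  Csum (map (fun n => Cmult (nth n rho (RtoC 0)) (tL n x z))
            (seq 0 (length rho))).

Definition xi (z : C) (x : R) : C :=
  Cexp (Cmult (Cmult Ci z) (RtoC (x ^ 2 / 2))).

(* a generator rho(x^2) xi_z (odd = false, in N_0)
   or rho(x^2) x xi_z (odd = true, in N_1) *)
Record gen := Gen { g_rho : poly; g_z : C; g_odd : bool }.

Definition valid_z (z : C) : Prop := 0 < Im z /\ z <> Ci.

Definition oddfac (b : bool) (x : R) : C := if b then RtoC x else RtoC 1.

Definition gen_fun (g : gen) (x : R) : C :=
  Cmult (Cmult (poly_eval_sq (g_rho g) x) (oddfac (g_odd g) x)) (xi (g_z g) x).

(* S^(rho(x^2) xi_z) = (i/2) [rho(t_z)L](x,z) xi_z  and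
   S^*(rho(x^2) x xi_z) = (i/2) [rho(t_z)L](x,z) x xi_z *)
Definition gen_S (g : gen) (x : R) : C :=
  Cmult (Cmult (Cmult (Cdiv Ci (RtoC 2)) (rhoL (g_rho g) x (g_z g)))
               (oddfac (g_odd g) x))
        (xi (g_z g) x).

(* formal finite linear combinations (coefficients absorbed in rho) *)
Definition formal := list gen.

Definition valid (F : formal) : Prop := List.Forall (fun g => valid_z (g_z g)) F.

Definition realize (F : formal) (x : R) : C := Csum (map (fun g => gen_fun g x) F).

Definition Sreal (F : formal) (x : R) : C := Csum (map (fun g => gen_S g x) F).

Definition even_part (F : formal) : formal := filter (fun g => negb (g_odd g)) F.
Definition odd_part (F : formal) : formal := filter (fun g => g_odd g) F.

Definition ip (f g : R -> C) : C :=
  RInt_gen (V := C_R_CompleteNormedModule)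
    (fun x => Cmult (Cconj (f x)) (g x))
    (Rbar_locally m_infty) (Rbar_locally p_infty).

Definition square_integrable (f : R -> C) : Prop :=
  ex_RInt_gen (fun x => Cmod (f x) ^ 2) (Rbar_locally m_infty) (Rbar_locally p_infty).

Definition t0_formal (P Q : formal) : C :=
  Cmult (RtoC (1/2)) (Cplus (ip (Sreal P) (realize Q)) (ip (realize P) (Sreal Q))).
Definition t1_formal (P Q : formal) : C :=
  Cmult (RtoC (1/2)) (Cplus (ip (Sreal P) (realize Q)) (ip (realize P) (Sreal Q))).

Definition that_formal (P Q : formal) : C :=
  Cplus (t0_formal (even_part P) (even_part Q)) (t1_formal (odd_part P) (odd_part Q)).

Definition InN (f : R -> C) : Prop := exists F, valid F /\ realize F = f.

Definition rep (f : R -> C) : formal :=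
  epsilon (inhabits nil) (fun F => valid F /\ realize F = f).

(* t^ as a form on N x N (evaluated through representations; that this
   is independent of the representation follows from the well-definedness
   of S^, which is part of the theorem) *)
Definition that (psi phi : R -> C) : C := that_formal (rep psi) (rep phi).

Definition rderiv (f : R -> C) (x : R) : C :=
  epsilon (inhabits (RtoC 0))
    (fun l => is_derive (K := R_AbsRing) (V := C_R_NormedModule) f x l).

Definition twice_differentiable (f : R -> C) : Prop :=
  (forall x, ex_derive (K := R_AbsRing) (V := C_R_NormedModule) f x) /\
  (forall x, ex_derive (K := R_AbsRing) (V := C_R_NormedModule) (rderiv f) x).

Definition hosc (f : R -> C) (x : R) : C :=
  Cmult (RtoC (1/2)) (Cplus (Copp (rderiv (rderiv f) x)) (Cmult (RtoC (x ^ 2)) (f x))).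

(* membership in D(h) = D(p^2) /\ D(q^2), for C^2 functions *)
Definition D_hosc (f : R -> C) : Prop :=
  twice_differentiable f /\ square_integrable f /\
  square_integrable (rderiv (rderiv f)) /\
  square_integrable (fun x => Cmult (RtoC (x ^ 2)) (f x)).

Definition fzero : R -> C := fun _ => RtoC 0.
Definition fadd (f g : R -> C) : R -> C := fun x => Cplus (f x) (g x).
Definition fscal (a : C) (f : R -> C) : R -> C := fun x => Cmult a (f x).

Definition subspace (P : (R -> C) -> Prop) : Prop :=
  P fzero /\ (forall f g, P f -> P g -> P (fadd f g)) /\
  (forall a f, P f -> P (fscal a f)).

Definition nonzero_subspace (P : (R -> C) -> Prop) : Prop :=
  subspace P /\ exists f, P f /\ f <> fzero.

Definition sesquilinear (D1 D2 : (R -> C) -> Prop) (t : (R -> C) -> (R -> C) -> C) : Prop :=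
  (forall a psi psi' phi, D1 psi -> D1 psi' -> D2 phi ->
     t (fadd psi (fscal a psi')) phi = Cplus (t psi phi) (Cmult (Cconj a) (t psi' phi))) /\
  (forall a psi phi phi', D1 psi -> D2 phi -> D2 phi' ->
     t psi (fadd phi (fscal a phi')) = Cplus (t psi phi) (Cmult a (t psi phi'))).

Definition ultra_weak_time_operator (DH : (R -> C) -> Prop) (H : (R -> C) -> (R -> C))
    (D1 D2 : (R -> C) -> Prop) (t : (R -> C) -> (R -> C) -> C)
    (D E : (R -> C) -> Prop) : Prop :=
  nonzero_subspace D1 /\ nonzero_subspace D2 /\ sesquilinear D1 D2 t /\
  nonzero_subspace D /\ nonzero_subspace E /\
  (forall f, D f -> D1 f /\ D2 f) /\ (forall f, E f -> D1 f /\ D2 f) /\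
  (forall f, E f -> DH f /\ D f) /\
  (forall phi psi, D phi -> D psi -> Cconj (t phi psi) = t psi phi) /\
  (forall phi, E phi -> D1 (H phi)) /\
  (forall phi psi, E phi -> E psi ->
     Cminus (t (H phi) psi) (Cconj (t (H psi) phi))
     = Cmult (Copp Ci) (ip phi psi)).

(* Main.v *)
Require Import Defs.
From Stdlib Require Import Reals List.
From Stdlib Require Import Lra Lia Factorial FunctionalExtensionality ClassicalEpsilon.
From Coquelicot Require Import Coquelicot.

(* The operator S (standing for S^ and S^* at once) maps polynomials times Gaussians to such
   functions, and the Leibniz rule for [(1 + z^2) L_1 = 2 i] gives [S h - h S = i].  As h is
   symmetric, the left side of the weak CCR is the sum over the two parities of
   [1/2 ((S h - h S) phi, psi) - 1/2 (phi, (S h - h S) psi) = -i (phi, psi)];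
   even and odd functions being orthogonal, this is the CCR on all of N.
   S is single-valued because the functions [s^n e^(w s)] on [s > 0] are linearly independent:
   applying [d/ds - lam] lowers the multiplicity of [lam], and its transpose is onto the
   linear functionals modulo one, evaluation at [(0, lam)]. *)

(** * Derivatives of the Cayley logarithm *)

(** [that] reads its arguments through [rep], and what [rep] picks for [hosc f] is unrelated to what
    it picks for [f]; so no computation with the form can start before S is known to be
    single-valued. The linear extension is therefore kept as a relation, [S_graph], on which the
    commutation relation is an induction over generators. Uniqueness is shown separately, and
    [that_eq] then admits any pairs of the graph in place of the chosen representations. The
    commutator comes down to one scalar recurrence because [hosc] sends x^(2n) xi_z, times x in the
    odd case, to a combination of such functions with exponents 2n+2, 2n, 2n-2 and the same z; its
    top coefficient (1 + z^2)/2 carries the denominator of L_1. For uniqueness, s = x^2 and w = i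
    z/2 turn xi_z into e^(w s). If sum a s^n e^(w s) vanishes for s > 0, the same coefficients
    annihilate every function of (n, w), in particular the value at x of the S-image of the
    generator with parameters n and w, whatever that value is. *)

Notation is_Cderive := (is_derive (K := C_AbsRing) (V := C_NormedModule)).

Lemma cderiv_eq (f : C -> C) (z l : C) : is_Cderive f z l -> cderiv f z = l.
Proof.
  intros H.
  assert (He : is_Cderive f z (cderiv f z)).
  { apply (epsilon_spec (inhabits (RtoC 0)) (fun l => is_Cderive f z l)).
    now exists l. }
  now rewrite <- (is_C_derive_unique f z _ H), <- (is_C_derive_unique f z _ He).
Qed.

Lemma is_Cderive_inv (z : C) : z <> 0 -> is_Cderive Cinv z (- / (z * z))%C.
Proof.
  intros Hz; split; [apply (is_linear_scal_l (K := C_AbsRing) (V := C_NormedModule)) |].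
  intros x Hx; apply (is_filter_lim_locally_unique (V := AbsRing_NormedModule C_AbsRing)) in Hx.
  rewrite <- Hx; clear x Hx; intros eps.
  assert (Hm := proj1 (Cmod_gt_0 z) Hz).
  (* On this ball |y| > |z|/2, so the remainder (y - z)^2 / (y z^2) is at most 2 |y - z|^2 / |z|^3;
     the second radius bounds this by eps |y - z|. *)
  assert (Hd : 0 < Rmin (Cmod z / 2) (eps * (Cmod z ^ 3 / 2))).
  { apply Rmin_glb_lt; [lra |]. apply Rmult_lt_0_compat; [apply cond_pos |].
    assert (0 < Cmod z ^ 3) by (apply pow_lt; lra). lra. }
  exists (mkposreal _ Hd); intros y Hy.
  change (Cmod (y - z)%C < Rmin (Cmod z / 2) (eps * (Cmod z ^ 3 / 2))) in Hy.
  change (Cmod ((/ y - / z) - (y - z) * (- / (z * z)))%C <= eps * Cmod (y - z)%C).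
  assert (H1 := Rlt_le_trans _ _ _ Hy (Rmin_l _ _)).
  assert (H2 := Rlt_le_trans _ _ _ Hy (Rmin_r _ _)).
  assert (H3 : Cmod z / 2 < Cmod y).
  { assert (H := Cmod_triangle y (z - y)%C).
    replace (y + (z - y))%C with z in H by ring.
    replace (z - y)%C with (- (y - z))%C in H by ring.
    rewrite Cmod_opp in H. lra. }
  assert (Hy0 : y <> RtoC 0) by (apply Cmod_gt_0; lra).
  replace ((/ y - / z) - (y - z) * (- / (z * z)))%C
    with ((y - z) * (y - z) * / (y * (z * z)))%C by (field; auto).
  rewrite !Cmod_mult, Cmod_inv, !Cmod_mult by (repeat apply Cmult_neq_0; auto).
  assert (Hd0 := Cmod_ge_0 (y - z)%C).
  rewrite (Rmult_comm eps), Rmult_assoc.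
  apply Rmult_le_compat_l; [exact Hd0 |].
  apply Rle_div_l; [apply Rmult_lt_0_compat; [lra |]; nra |].
  apply Rlt_le, (Rlt_le_trans _ _ _ H2).
  apply Rmult_le_compat_l; [apply Rlt_le, cond_pos |]. simpl. nra.
Qed.

(* [C_NormedModule] and [AbsRing_NormedModule C_AbsRing] share the norm but not the uniform structure. *)
Lemma is_Cderive_AbsRing (f : C -> C) (z l : C) :
  is_Cderive f z l <-> is_derive (K := C_AbsRing) (V := AbsRing_NormedModule C_AbsRing) f z l.
Proof.
  split; intros [_ H]; (split; [apply is_linear_scal_l | exact H]).
Qed.

Lemma is_Cderive_inv_pow (a z : C) (n : nat) :
  (z - a)%C <> 0 ->
  is_Cderive (fun w => ((/ (w - a)) ^ n)%C) z (- INR n * (/ (z - a)) ^ S n)%C.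
Proof.
  intros Hz; induction n as [|n IH].
  - evar_last; [apply (is_derive_const (K := C_AbsRing) (V := C_NormedModule) (RtoC 1)) |].
    change (@zero C_NormedModule) with (RtoC 0). simpl INR. ring.
  - assert (H1 : is_Cderive (fun w => (/ (w - a))%C) z (- (/ (z - a)) ^ 2)%C).
    { evar_last.
      - apply (is_derive_comp (K := C_AbsRing) (V := C_NormedModule) Cinv (fun w => (w - a)%C)).
        + apply is_Cderive_inv, Hz.
        + apply (is_derive_minus (K := C_AbsRing) (V := AbsRing_NormedModule C_AbsRing)).
          * apply (is_derive_id (K := C_AbsRing)).
          * apply (is_derive_const (K := C_AbsRing)).
      - change ((1 - 0) * (- / ((z - a) * (z - a))) = - (/ (z - a)) ^ 2)%C. field. exact Hz. }
    replace (- INR (S n) * (/ (z - a)) ^ S (S n))%C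
      with (- (/ (z - a)) ^ 2 * (/ (z - a)) ^ n + / (z - a) * (- INR n * (/ (z - a)) ^ S n))%C
      by (rewrite S_INR, RtoC_plus, !Cpow_S; ring).
    apply is_Cderive_AbsRing; apply is_Cderive_AbsRing in H1; apply is_Cderive_AbsRing in IH.
    exact (is_derive_mult (K := C_AbsRing) _ _ z _ _ H1 IH Cmult_comm).
Qed.

(** Partial fractions: 2i/(1 + z^2) = 1/(z - i) - 1/(z + i), and this is the k-th derivative of the
    right-hand side. *)
Definition Lres (k : nat) (z : C) : C :=
  (((/ (z - Ci)) ^ S k - (/ (z - - Ci)) ^ S k) * (INR (fact k) * (-1) ^ k))%C.

Lemma is_Cderive_Lres (k : nat) (z : C) :
  (z - Ci)%C <> 0 -> (z - - Ci)%C <> 0 -> is_Cderive (Lres k) z (Lres (S k) z).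
Proof.
  intros H1 H2. apply is_Cderive_AbsRing. unfold Lres. evar_last.
  - apply (is_derive_scal_l (K := C_AbsRing) (V := AbsRing_NormedModule C_AbsRing)).
    apply (is_derive_minus (K := C_AbsRing) (V := AbsRing_NormedModule C_AbsRing));
      apply is_Cderive_AbsRing, is_Cderive_inv_pow; assumption.
  - change ((- INR (S k) * (/ (z - Ci)) ^ S (S k) - - INR (S k) * (/ (z - - Ci)) ^ S (S k))
      * (INR (fact k) * (-1) ^ k) =
      ((/ (z - Ci)) ^ S (S k) - (/ (z - - Ci)) ^ S (S k)) * (INR (fact (S k)) * (-1) ^ S k))%C.
    rewrite fact_simpl, mult_INR, RtoC_mult, (Cpow_S (-1)). ring.
Qed.

Lemma locally_neq (a z : C) :
  (z - a)%C <> 0 -> locally (T := AbsRing_UniformSpace C_AbsRing) z (fun w : C => (w - a)%C <> 0).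
Proof.
  intros Hz. exists (mkposreal _ (proj1 (Cmod_gt_0 _) Hz)). intros y Hy Hya.
  change (Cmod (y - z)%C < Cmod (z - a)%C) in Hy.
  replace (y - z)%C with ((y - a) - (z - a))%C in Hy by ring.
  rewrite Hya in Hy. replace (0 - (z - a))%C with (- (z - a))%C in Hy by ring.
  rewrite Cmod_opp in Hy. lra.
Qed.

Lemma Ci_sqr : (Ci * Ci = - (1))%C.
Proof. apply injective_projections; simpl; ring. Qed.

Lemma iter_cderiv_Lgen (k : nat) (z : C) :
  (z - Ci)%C <> 0 -> (z - - Ci)%C <> 0 -> Nat.iter k cderiv Lgen z = Lres k z.
Proof.
  revert z; induction k as [|k IH]; intros z H1 H2.
  - unfold Lgen, Lres; simpl.
    replace (1 + z * z)%C with ((z - Ci) * (z - - Ci))%C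
      by (ring_simplify; replace (Ci ^ 2)%C with (Ci * Ci)%C by ring; rewrite Ci_sqr; ring).
    field. auto.
  - simpl Nat.iter. apply cderiv_eq.
    (* The induction hypothesis holds only off the two poles, but that is a neighbourhood of [z],
       which is all that the next derivative sees. *)
    apply (is_derive_ext_loc (K := C_AbsRing) (V := C_NormedModule) (Lres k)).
    + apply (filter_imp _ _ (fun w Hw => eq_sym (IH w (proj1 Hw) (proj2 Hw)))).
      apply filter_and; now apply locally_neq.
    + now apply is_Cderive_Lres.
Qed.

(* Leibniz rule for the derivatives of [(1 + z^2) Lgen z = 2 i]. *)
Lemma Lk_rec (k : nat) (z : C) :
  valid_z z ->
  ((1 + z * z) * Lk (S k) z + 2 * INR k * z * Lk k z + INR k * (INR k - 1) * Lk (pred k) z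
   = match k with O => 2 * Ci | S _ => 0 end)%C.
Proof.
  intros [Hz Hi].
  assert (H1 : (z - Ci)%C <> 0).
  { intros H. apply Hi. replace z with ((z - Ci) + Ci)%C by ring. rewrite H. ring. }
  assert (H2 : (z - - Ci)%C <> 0).
  { intros H. replace z with ((z - - Ci) - Ci)%C in Hz by ring. rewrite H in Hz. simpl in Hz. lra. }
  assert (Hz2 : (1 + z * z = (z - Ci) * (z - - Ci))%C).
  { ring_simplify; replace (Ci ^ 2)%C with (Ci * Ci)%C by ring; rewrite Ci_sqr; ring. }
  (* [Lk 0 z] is the logarithm itself and not an iterated derivative of [Lgen]. It occurs only for k
     = 0 and k = 1, each time with a coefficient k or k(k-1) equal to 0; hence these two cases are
     split off, and all three are rational identities in 1/(z - i) and 1/(z + i). *)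
  destruct k as [|[|k]]; simpl pred; unfold Lk; rewrite ?iter_cderiv_Lgen by assumption.
  - rewrite Hz2. unfold Lres; simpl. field; auto.
  - rewrite Hz2; unfold Lres; simpl. field; auto.
  - rewrite Hz2; unfold Lres. rewrite !fact_simpl, !mult_INR, !RtoC_mult, !S_INR, !RtoC_plus.
    rewrite !Cpow_S.
    generalize ((/ (z - Ci)) ^ k)%C ((/ (z - - Ci)) ^ k)%C ((-1) ^ k)%C; intros.
    field. auto.
Qed.

(** * The polynomials [tL n x z] in [x ^ 2] *)

(** This is (s + E)^n applied to [c] and read at index 0, where E shifts the sequence by one. With E
    standing for -2i d/dz, which commutes with multiplication by x^2, it becomes t_z^n; the
    recursion peels off one factor s + E, so that proofs need no binomial sums. *)
Fixpoint umbral (n : nat) (c : nat -> C) (s : C) : C :=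
  match n with
  | O => c O
  | S m => (s * umbral m c s + umbral m (fun k => c (S k)) s)%C
  end.

Lemma umbral_ext (n : nat) (c d : nat -> C) (s : C) :
  (forall k, c k = d k) -> umbral n c s = umbral n d s.
Proof.
  revert c d; induction n as [|n IH]; intros c d H; simpl; [apply H |].
  rewrite (IH c d H). f_equal. apply IH. intros k; apply H.
Qed.

Lemma umbral_lin (n : nat) (a : C) (c d : nat -> C) (s : C) :
  umbral n (fun k => a * c k + d k)%C s = (a * umbral n c s + umbral n d s)%C.
Proof.
  revert c d; induction n as [|n IH]; intros c d; simpl; [ring |].
  rewrite IH, (IH (fun k => c (S k)) (fun k => d (S k))). ring.
Qed.

Lemma umbral_zero (n : nat) (s : C) : umbral n (fun _ => RtoC 0) s = 0.
Proof. induction n as [|n IH]; simpl; [reflexivity |]. rewrite IH. ring. Qed.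

(** The sequence on which (s + E)^n leaves only s^n. With it, a generator and its image under S are
    both a [wave] and differ only in the sequence. *)
Definition delta0 (k : nat) : C := match k with O => RtoC 1 | S _ => RtoC 0 end.

Lemma umbral_delta0 (n : nat) (s : C) : umbral n delta0 s = (s ^ n)%C.
Proof.
  induction n as [|n IH]; simpl; [reflexivity |].
  rewrite IH, umbral_zero. ring.
Qed.

(** In exponential generating functions, [umbral n c s] is n! times the coefficient of t^n in e^(s
    t) * sum c_k t^k / k!, and passing from d_k to k d_(k-1) is multiplication by t. *)
Lemma umbral_lower (n : nat) (d : nat -> C) (s : C) :
  umbral n (fun k => INR k * d (pred k))%C s = (INR n * umbral (pred n) d s)%C.
Proof.
  revert d; induction n as [|n IH]; intros d; [reflexivity |].
  cbn [umbral]; rewrite IH.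
  rewrite (umbral_ext n _ (fun k => 1 * d k + INR k * d (S (pred k)))%C).
  2: { intros [|k]; [simpl; ring |]. cbn [pred]. rewrite (S_INR (S k)), RtoC_plus. ring. }
  assert (E := IH (fun j => d (S j))). cbn beta in E.
  rewrite umbral_lin, E. destruct n as [|n]; cbn [pred].
  - simpl. ring.
  - cbn [umbral]. rewrite (S_INR (S n)), RtoC_plus. ring.
Qed.

(* Unlike [Binomial.C], this vanishes for [n < k]. *)
Fixpoint binom (n k : nat) : R :=
  match n, k with
  | _, O => 1
  | O, S _ => 0
  | S m, S j => binom m j + binom m (S j)
  end.

Lemma binom_lt (n k : nat) : (n < k)%nat -> binom n k = 0.
Proof.
  revert k; induction n as [|n IH]; intros [|k] H; simpl; try lia; [reflexivity |].
  rewrite !IH by lia. ring.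
Qed.

Lemma binom_Binomial (n k : nat) : (k <= n)%nat -> Binomial.C n k = binom n k.
Proof.
  revert k; induction n as [|n IH]; intros [|k] H; simpl; try lia.
  - unfold Binomial.C; simpl; field.
  - unfold Binomial.C; rewrite Nat.sub_0_r; simpl fact at 2. simpl INR at 2.
    field. apply INR_fact_neq_0.
  - destruct (Nat.eq_dec k n) as [->|Hk].
    + rewrite (binom_lt n (S n)), <- IH by lia. unfold Binomial.C. rewrite !Nat.sub_diag.
      change (INR (fact 0)) with 1. field. split; apply INR_fact_neq_0.
    + rewrite <- !IH, <- pascal by lia. reflexivity.
Qed.

Lemma Csum_ext (A : Type) (f g : A -> C) (l : list A) :
  (forall x, In x l -> f x = g x) -> Csum (map f l) = Csum (map g l).
Proof. intros H; f_equal. now apply map_ext_in. Qed.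

Lemma Csum_plus (A : Type) (f g : A -> C) (l : list A) :
  Csum (map (fun x => f x + g x)%C l) = (Csum (map f l) + Csum (map g l))%C.
Proof. unfold Csum. induction l as [|x l IH]; simpl; [ring |]. rewrite IH. ring. Qed.

Lemma Csum_scal (A : Type) (a : C) (f : A -> C) (l : list A) :
  Csum (map (fun x => a * f x)%C l) = (a * Csum (map f l))%C.
Proof. unfold Csum. induction l as [|x l IH]; simpl; [ring |]. rewrite IH. ring. Qed.

Lemma Csum_app (l l' : list C) : Csum (l ++ l') = (Csum l + Csum l')%C.
Proof. unfold Csum. induction l as [|x l IH]; simpl; [ring |]. rewrite IH. ring. Qed.

Lemma Csum_cons (a : C) (l : list C) : Csum (a :: l) = (a + Csum l)%C.
Proof. reflexivity. Qed.

Lemma umbral_sum (n : nat) (c : nat -> C) (s : C) :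
  umbral n c s = Csum (map (fun k => binom n k * s ^ (n - k) * c k)%C (seq 0 (S n))).
Proof.
  revert c; induction n as [|n IH]; intros c; [simpl; unfold Csum; simpl; ring |].
  (* The range grows by the index n+1 for free, since [binom n (S n)] is 0; Pascal's rule can then
     be applied term by term. *)
  assert (Hs : (s * Csum (map (fun k => binom n k * s ^ (n - k) * c k) (seq 0 (S n)))
    = Csum (map (fun k => binom n k * s ^ (S n - k) * c k) (seq 0 (S (S n)))))%C).
  { rewrite (seq_S (S n)), map_app, Csum_app, <- Csum_scal.
    rewrite (Csum_ext _ (fun x => s * (binom n x * s ^ (n - x) * c x))%C
      (fun k => binom n k * s ^ (S n - k) * c k)%C).
    - unfold Csum at 3; simpl fold_right. rewrite (binom_lt n (S n)) by lia. ring.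
    - intros k Hk; apply in_seq in Hk. replace (S n - k)%nat with (S (n - k)) by lia.
      rewrite Cpow_S. ring. }
  cbn [umbral]; rewrite !IH, Hs.
  replace (seq 0 (S (S n))) with (0%nat :: map S (seq 0 (S n)))%list
    by (now rewrite seq_shift).
  cbn [map]; rewrite !map_map.
  rewrite !Csum_cons, <- Cplus_assoc, <- Csum_plus. f_equal.
  - f_equal. destruct n; reflexivity.
  - apply Csum_ext; intros k _. simpl binom; simpl Nat.sub. rewrite RtoC_plus. ring.
Qed.

Definition Lcoef (z : C) (k : nat) : C := ((RtoC (-2) * Ci) ^ k * Lk k z)%C.

Lemma tL_umbral (n : nat) (x : R) (z : C) : tL n x z = umbral n (Lcoef z) (RtoC (x ^ 2)).
Proof.
  unfold tL; rewrite umbral_sum. apply Csum_ext; intros k Hk; apply in_seq in Hk.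
  rewrite binom_Binomial, pow_mult, RtoC_mult, (RtoC_pow (x ^ 2)) by lia.
  unfold Lcoef. ring.
Qed.

(** This is [Lk_rec] times (-2i)^(k+1), and 2i * (-2i) gives the 4. The factor k(k-1) is nested so
    that [umbral_lower] can be applied to it twice. *)
Lemma Lcoef_rec (k : nat) (z : C) :
  valid_z z ->
  ((1 + z * z) * Lcoef z (S k) - 4 * Ci * z * (INR k * Lcoef z k)
    - 4 * (INR k * (INR (pred k) * Lcoef z (pred k))) = 4 * delta0 k)%C.
Proof.
  intros Hz. assert (H := Lk_rec k z Hz). unfold Lcoef.
  destruct k as [|k]; cbn [pred delta0] in *.
  - rewrite !Cpow_S. change (INR 0) with 0 in *. simpl Cpow.
    replace ((1 + z * z) * (-2 * Ci * 1 * Lk 1 z))%C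
      with (-2 * Ci * ((1 + z * z) * Lk 1 z + 2 * 0 * z * Lk 0 z + 0 * (0 - 1) * Lk 0 z))%C by ring.
    rewrite H. replace (-2 * Ci * (2 * Ci))%C with (-4 * (Ci * Ci))%C by ring. rewrite Ci_sqr. ring.
  - assert (HI : ((-2 * Ci) * (-2 * Ci) = -4)%C).
    { replace ((-2 * Ci) * (-2 * Ci))%C with (4 * (Ci * Ci))%C by ring. rewrite Ci_sqr. ring. }
    rewrite (S_INR k), RtoC_plus in *. rewrite !Cpow_S.
    (* The last summand is zero because (-2 Ci)^2 = -4; with it the equality holds even when [Ci] is
       a free variable. *)
    transitivity ((-2 * Ci) * (-2 * Ci) * (-2 * Ci) ^ k *
      ((1 + z * z) * Lk (S (S k)) z + 2 * (INR k + 1) * z * Lk (S k) z +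
       (INR k + 1) * (INR k + 1 - 1) * Lk k z)
      + (4 + (-2 * Ci) * (-2 * Ci)) * - (((INR k + 1) * INR k * ((-2 * Ci) ^ k * Lk k z))))%C.
    + ring.
    + rewrite H, HI. ring.
Qed.

(** Apply (s + E)^n to [Lcoef_rec]: each difference [umbral (S m) c s - s * umbral m c s] is the
    polynomial of the shifted sequence, and [umbral_lower] turns the factors k into n. Exactly these
    differences survive in S h - h S, where S replaces s^m by a polynomial and h multiplies by s. *)
Lemma umbral_Lcoef_rec (n : nat) (z s : C) :
  valid_z z ->
  ((1 + z * z) * (umbral (S n) (Lcoef z) s - s * umbral n (Lcoef z) s)
    - 4 * Ci * z * (INR n * (umbral n (Lcoef z) s - s * umbral (pred n) (Lcoef z) s))
    - 4 * (INR n * (INR (pred n) *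
        (umbral (pred n) (Lcoef z) s - s * umbral (pred (pred n)) (Lcoef z) s)))
   = 4 * s ^ n)%C.
Proof.
  intros Hz. set (c := Lcoef z). set (d := fun k => c (S k)).
  assert (Hrec : forall k, ((1 + z * z) * d k - 4 * Ci * z * (INR k * d (pred k))
    - 4 * (INR k * (INR (pred k) * d (pred (pred k)))) = 4 * delta0 k)%C).
  { intros k. rewrite <- (Lcoef_rec k z Hz). unfold d, c.
    destruct k as [|[|k]]; cbn [pred]; simpl INR; ring. }
  assert (HU : forall m, (INR m * (umbral m c s - s * umbral (pred m) c s) =
     INR m * umbral (pred m) d s)%C).
  { intros [|m]; cbn [pred umbral]; [simpl INR; ring |]. fold d. ring. }
  transitivity ((1 + z * z) * umbral n d s - 4 * Ci * z * (INR n * umbral (pred n) d s)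
    - 4 * (INR n * (INR (pred n) * umbral (pred (pred n)) d s)))%C.
  { rewrite !HU. cbn [umbral]. fold d. ring. }
  rewrite <- (umbral_lower (pred n) d s), <- (umbral_lower n d s).
  rewrite <- (umbral_lower n (fun k => INR k * d (pred k))%C s).
  rewrite <- umbral_delta0.
  transitivity (umbral n (fun k => (1 + z * z) * d k +
     ((- (4 * Ci * z)) * (INR k * d (pred k)) + ((- (4)) * (INR k * (INR (pred k) * d (pred (pred k)))) + 0)))%C s).
  { rewrite !umbral_lin, umbral_zero. ring. }
  transitivity (umbral n (fun k => 4 * delta0 k + 0)%C s).
  - apply umbral_ext; intros k. rewrite <- Hrec. ring.
  - rewrite umbral_lin, umbral_zero. ring.
Qed.

(** * The oscillator on polynomials times Gaussians *)

Notation is_Rderive := (is_derive (K := R_AbsRing) (V := C_R_NormedModule)).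

Lemma is_Rderive_pair (f : R -> C) (x : R) (l : C) :
  is_Rderive f x l <->
  is_derive (fun t => Re (f t)) x (Re l) /\ is_derive (fun t => Im (f t)) x (Im l).
Proof.
  split.
  - intros H; split.
    + apply (filterdiff_comp' (U := AbsRing_NormedModule R_AbsRing) (V := C_R_NormedModule) (W := R_NormedModule)
        f Re x _ (fun t => Re t) H).
      apply filterdiff_linear. apply (is_linear_fst (K := R_AbsRing) (U := R_NormedModule) (V := R_NormedModule)).
    + apply (filterdiff_comp' (U := AbsRing_NormedModule R_AbsRing) (V := C_R_NormedModule) (W := R_NormedModule)
        f Im x _ (fun t => Im t) H).
      apply filterdiff_linear. apply (is_linear_snd (K := R_AbsRing) (U := R_NormedModule) (V := R_NormedModule)).
  - intros [H1 H2].
    apply (is_derive_ext (V := C_R_NormedModule)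
      (fun t => plus (scal (Re (f t)) ((1, 0) : C_R_NormedModule)) (scal (Im (f t)) ((0, 1) : C_R_NormedModule)))).
    { intros t. apply injective_projections; simpl; unfold plus, scal, mult; simpl; unfold mult; simpl;
        unfold Re, Im; ring. }
    evar_last.
    + apply (is_derive_plus (V := C_R_NormedModule));
        apply (is_derive_scal_l (V := C_R_NormedModule)); [exact H1 | exact H2].
    + apply injective_projections; simpl; unfold plus, scal, mult; simpl; unfold mult; simpl;
        unfold Re, Im; ring.
Qed.

Lemma is_Rderive_unique (f : R -> C) (x : R) (l l' : C) :
  is_Rderive f x l -> is_Rderive f x l' -> l = l'.
Proof.
  rewrite !is_Rderive_pair. intros [H1 H2] [H3 H4].
  apply injective_projections.
  - change (Re l = Re l'). now rewrite <- (is_derive_unique _ _ _ H1), <- (is_derive_unique _ _ _ H3).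
  - change (Im l = Im l'). now rewrite <- (is_derive_unique _ _ _ H2), <- (is_derive_unique _ _ _ H4).
Qed.

Lemma rderiv_eq (f : R -> C) (x : R) (l : C) : is_Rderive f x l -> rderiv f x = l.
Proof.
  intros H. apply (is_Rderive_unique f x); [| exact H].
  apply (epsilon_spec (inhabits (RtoC 0)) (fun l => is_Rderive f x l)). now exists l.
Qed.

Lemma is_Rderive_const (a : C) (x : R) : is_Rderive (fun _ => a) x (RtoC 0).
Proof. apply (is_derive_const (V := C_R_NormedModule)). Qed.

Lemma is_Rderive_plus (f g : R -> C) (x : R) (l m : C) :
  is_Rderive f x l -> is_Rderive g x m -> is_Rderive (fun t => f t + g t)%C x (l + m)%C.
Proof. apply (is_derive_plus (V := C_R_NormedModule)). Qed.

Lemma is_Rderive_mult (f g : R -> C) (x : R) (l m : C) :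
  is_Rderive f x l -> is_Rderive g x m ->
  is_Rderive (fun t => f t * g t)%C x (l * g x + f x * m)%C.
Proof.
  rewrite !is_Rderive_pair. intros [H1 H2] [H3 H4].
  assert (M := fun u v (du dv : R) (Hu : is_derive u x du) (Hv : is_derive v x dv) =>
    is_derive_mult (K := R_AbsRing) u v x du dv Hu Hv Rmult_comm).
  split.
  - evar_last; [exact (is_derive_minus _ _ _ _ _ (M _ _ _ _ H1 H3) (M _ _ _ _ H2 H4)) |].
    unfold minus, plus, opp, mult; simpl; unfold Re, Im; ring.
  - evar_last; [exact (is_derive_plus _ _ _ _ _ (M _ _ _ _ H1 H4) (M _ _ _ _ H2 H3)) |].
    unfold minus, plus, opp, mult; simpl; unfold Re, Im; ring.
Qed.

Lemma is_Rderive_scal (a : C) (f : R -> C) (x : R) (l : C) :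
  is_Rderive f x l -> is_Rderive (fun t => a * f t)%C x (a * l)%C.
Proof.
  intros H. replace (a * l)%C with (0 * f x + a * l)%C by ring.
  apply is_Rderive_mult; [apply is_Rderive_const | exact H].
Qed.

Lemma is_Rderive_RtoC (f : R -> R) (x l : R) :
  is_derive f x l -> is_Rderive (fun t => RtoC (f t)) x (RtoC l).
Proof.
  intros H; apply is_Rderive_pair; split; simpl; [exact H |].
  apply (is_derive_const (K := R_AbsRing) (V := R_NormedModule)).
Qed.

Lemma is_Rderive_pow (m : nat) (x : R) :
  is_Rderive (fun t => (RtoC t ^ m)%C) x (INR m * RtoC x ^ pred m)%C.
Proof.
  apply (is_derive_ext (V := C_R_NormedModule) (fun t => RtoC (t ^ m))).
  { intros t; apply RtoC_pow. }
  rewrite <- RtoC_pow, <- RtoC_mult.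
  apply is_Rderive_RtoC. auto_derive; [trivial | ring].
Qed.

Lemma is_Rderive_conj (f : R -> C) (x : R) (l : C) :
  is_Rderive f x l -> is_Rderive (fun t => Cconj (f t)) x (Cconj l).
Proof.
  rewrite !is_Rderive_pair. intros [H1 H2]; split; simpl; [exact H1 |].
  apply (is_derive_opp (fun t => Im (f t))), H2.
Qed.

(** The coefficient of x^2 is an arbitrary complex number, so that conjugates and products of
    Gaussians stay in the family. *)
Definition gauss (c : C) (x : R) : C := Cexp (c * RtoC (x ^ 2)).

Lemma is_Rderive_gauss (c : C) (x : R) :
  is_Rderive (gauss c) x (2 * c * x * gauss c x)%C.
Proof.
  assert (E : forall t, gauss c t =
    (exp (Re c * t ^ 2) * cos (Im c * t ^ 2), exp (Re c * t ^ 2) * sin (Im c * t ^ 2))).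
  { intros t. unfold gauss, Cexp. simpl.
    replace (fst c * (t * (t * 1)) - snd c * 0) with (Re c * (t * (t * 1))) by (unfold Re; ring).
    replace (fst c * 0 + snd c * (t * (t * 1))) with (Im c * (t * (t * 1))) by (unfold Im; ring).
    reflexivity. }
  apply (is_derive_ext (V := C_R_NormedModule) _ _ _ _ (fun t => eq_sym (E t))).
  rewrite E. apply is_Rderive_pair; simpl; split; auto_derive; trivial; unfold Re, Im; ring.
Qed.

Lemma xi_gauss (z : C) : xi z = gauss (Ci * z / 2)%C.
Proof.
  apply functional_extensionality; intros x. unfold xi, gauss. f_equal.
  unfold Rdiv. rewrite RtoC_mult, RtoC_inv by lra. field.
Qed.

Lemma Cexp_plus (u v : C) : Cexp (u + v) = (Cexp u * Cexp v)%C.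
Proof.
  unfold Cexp. change (Re (u + v)%C) with (Re u + Re v). change (Im (u + v)%C) with (Im u + Im v).
  rewrite exp_plus, cos_plus, sin_plus.
  apply injective_projections; simpl; ring.
Qed.

(** Appell property: d/ds (s + E)^n = n (s + E)^(n-1) for every sequence; the factor 2x is that of s
    = x^2. *)
Lemma is_Rderive_umbral (n : nat) (c : nat -> C) (x : R) :
  is_Rderive (fun t => umbral n c (RtoC (t ^ 2))) x
    (2 * x * (INR n * umbral (pred n) c (RtoC (x ^ 2))))%C.
Proof.
  revert c; induction n as [|n IH]; intros c.
  - cbn [umbral]. replace (2 * x * (INR 0 * umbral (pred 0) c (RtoC (x ^ 2))))%C with (RtoC 0)
      by (simpl INR; ring). apply is_Rderive_const.
  - cbn [umbral pred].
    evar_last.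
    + apply is_Rderive_plus; [| apply IH].
      apply is_Rderive_mult; [| apply IH].
      apply (is_Rderive_RtoC (fun t => t ^ 2) x (2 * x)). auto_derive; [trivial | ring].
    + rewrite S_INR, RtoC_plus, RtoC_mult. destruct n as [|n]; cbn [pred umbral]; [simpl INR |]; ring.
Qed.

Definition doddfac (b : bool) : C := if b then RtoC 1 else RtoC 0.

Lemma is_Rderive_oddfac (b : bool) (x : R) :
  is_Rderive (oddfac b) x (doddfac b).
Proof.
  destruct b; unfold oddfac.
  - apply (is_Rderive_RtoC (fun t => t)), (is_derive_id (K := R_AbsRing)).
  - apply is_Rderive_const.
Qed.

Definition wave (b : bool) (n : nat) (c : nat -> C) (z : C) (x : R) : C :=
  (umbral n c (RtoC (x ^ 2)) * oddfac b x * xi z x)%C.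

Ltac Rderive_rules :=
  lazymatch goal with
  | |- is_derive (fun t => umbral ?n ?c _) _ _ => apply is_Rderive_umbral
  | |- is_derive (fun t => oddfac ?b t) _ _ => apply is_Rderive_oddfac
  | |- is_derive (fun t => gauss ?a t) _ _ => apply is_Rderive_gauss
  | |- is_derive (fun t => Cplus (@?f t) (@?g t)) _ _ =>
      apply (is_Rderive_plus f g); Rderive_rules
  | |- is_derive (fun t => Cmult (@?f t) (@?g t)) _ _ =>
      apply (is_Rderive_mult f g); Rderive_rules
  | |- is_derive (fun _ => ?a) _ _ => apply (is_Rderive_const a)
  end.

(** With e^(a x^2) and 2a = i z, the potential and the twice differentiated exponential combine to
    (1 - 4a^2) x^2 / 2 = (1 + z^2) x^2 / 2. The constant 1 or 3 is 1 + 2m for the prefactor x^m; the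
    2m comes from the cross terms with the derivative of x^m. *)
Lemma hosc_wave (b : bool) (n : nat) (c : nat -> C) (z : C) (x : R) :
  hosc (wave b n c z) x =
  (1 / 2 * ((1 + z * z) * (RtoC (x ^ 2) * umbral n c (RtoC (x ^ 2)))
    - Ci * z * (4 * RtoC (x ^ 2) * (INR n * umbral (pred n) c (RtoC (x ^ 2)))
                + (if b then 3 else 1) * umbral n c (RtoC (x ^ 2)))
    - 2 * (if b then 3 else 1) * (INR n * umbral (pred n) c (RtoC (x ^ 2)))
    - 4 * RtoC (x ^ 2) * (INR n * (INR (pred n) * umbral (pred (pred n)) c (RtoC (x ^ 2)))))
   * oddfac b x * xi z x)%C.
Proof.
  set (a := (Ci * z / 2)%C).
  set (w1 := fun t : R =>
    (* [oddfac true t] is [t], written in a form that [Rderive_rules] can differentiate once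
       more. *)
    (2 * oddfac true t * (INR n * umbral (pred n) c (RtoC (t ^ 2))) * oddfac b t * gauss a t
     + umbral n c (RtoC (t ^ 2)) * (doddfac b) * gauss a t
     + umbral n c (RtoC (t ^ 2)) * oddfac b t * (2 * a * oddfac true t * gauss a t))%C).
  assert (H1 : rderiv (wave b n c z) = w1).
  { apply functional_extensionality; intros t. apply rderiv_eq.
    unfold wave. rewrite xi_gauss. fold a.
    evar_last; [Rderive_rules | unfold w1; change (oddfac true t) with (RtoC t); ring]. }
  unfold hosc. rewrite H1.
  erewrite (rderiv_eq w1); [| unfold w1; Rderive_rules].
  unfold wave. rewrite xi_gauss. fold a.
  simpl pow. rewrite Rmult_1_r, RtoC_mult. set (g := gauss a x).
  replace (z * z)%C with (- (4 * (a * a)))%C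
    by (unfold a; transitivity (- (Ci * Ci * (z * z)))%C; [field | rewrite Ci_sqr; ring]).
  replace (Ci * z)%C with (2 * a)%C by (unfold a; field).
  rewrite RtoC_div by lra. unfold oddfac, doddfac. destruct b; field.
Qed.

(** * Linear independence of [s ^ n * exp (w * s)] *)

(** A list of triples (a, n, w) stands for sum a s^n e^(w s), repetitions allowed. Saying that it
    pairs to 0 with every function of (n, w) expresses that all coefficients vanish, without first
    collecting equal terms. *)
Definition pairing (M : list (C * nat * C)) (gam : nat -> C -> C) : C :=
  Csum (map (fun t => fst (fst t) * gam (snd (fst t)) (snd t))%C M).

Lemma pairing_ext (M : list (C * nat * C)) (g h : nat -> C -> C) :
  (forall n w, g n w = h n w) -> pairing M g = pairing M h.
Proof. intros H. apply Csum_ext; intros t _. now rewrite H. Qed.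

Lemma pairing_lin (M : list (C * nat * C)) (a : C) (g h : nat -> C -> C) :
  pairing M (fun n w => g n w + a * h n w)%C = (pairing M g + a * pairing M h)%C.
Proof.
  unfold pairing. rewrite <- Csum_scal, <- Csum_plus. apply Csum_ext; intros t _. ring.
Qed.

Lemma pairing_app (M N : list (C * nat * C)) (g : nat -> C -> C) :
  pairing (M ++ N) g = (pairing M g + pairing N g)%C.
Proof. unfold pairing. now rewrite map_app, Csum_app. Qed.

Definition expmon (s : R) (n : nat) (w : C) : C := (RtoC s ^ n * Cexp (w * s))%C.

Lemma is_Rderive_expmon (n : nat) (w : C) (s : R) :
  is_Rderive (fun t => expmon t n w) s (w * expmon s n w + INR n * expmon s (pred n) w)%C.
Proof.
  assert (H : is_Rderive (fun t : R => Cexp (w * t)) s (w * Cexp (w * s))%C).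
  { assert (E : forall t : R, Cexp (w * t) =
      (exp (Re w * t) * cos (Im w * t), exp (Re w * t) * sin (Im w * t))).
    { intros t. unfold Cexp. simpl.
      replace (fst w * t - snd w * 0) with (Re w * t) by (unfold Re; ring).
      replace (fst w * 0 + snd w * t) with (Im w * t) by (unfold Im; ring).
      reflexivity. }
    apply (is_derive_ext (V := C_R_NormedModule) _ _ _ _ (fun t => eq_sym (E t))).
    rewrite E. apply is_Rderive_pair; simpl; split; auto_derive; trivial; unfold Re, Im; ring. }
  unfold expmon. evar_last; [apply (is_Rderive_mult _ _ _ _ _ (is_Rderive_pow n s) H) |].
  ring.
Qed.

Lemma is_Rderive_pairing_expmon (M : list (C * nat * C)) (s : R) :
  is_Rderive (fun t => pairing M (expmon t)) s
    (pairing M (fun n w => w * expmon s n w + INR n * expmon s (pred n) w)%C).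
Proof.
  unfold pairing; induction M as [|[[a n] w] M IH]; cbn [map fst snd].
  - apply is_Rderive_const.
  - apply is_Rderive_plus; [| exact IH].
    apply is_Rderive_scal, is_Rderive_expmon.
Qed.

(* The action of [d/ds - lam] on [sum a s^n e^(w s)]. *)
Definition shift (lam : C) (M : list (C * nat * C)) : list (C * nat * C) :=
  flat_map (fun t =>
    ((fst (fst t) * (snd t - lam), snd (fst t), snd t)
     :: (fst (fst t) * INR (snd (fst t)), pred (snd (fst t)), snd t) :: nil)%C) M.

Lemma pairing_shift (lam : C) (M : list (C * nat * C)) (g : nat -> C -> C) :
  pairing (shift lam M) g =
  pairing M (fun n w => (w - lam) * g n w + INR n * g (pred n) w)%C.
Proof.
  unfold pairing, shift; induction M as [|[[a n] w] M IH]; [reflexivity |].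
  cbn [flat_map map app fst snd]. rewrite !Csum_cons, IH. ring.
Qed.

Lemma shift_expmon_vanish (lam : C) (M : list (C * nat * C)) :
  (forall s, 0 < s -> pairing M (expmon s) = 0) ->
  forall s, 0 < s -> pairing (shift lam M) (expmon s) = 0.
Proof.
  intros H s Hs.
  assert (D : pairing M (fun n w => w * expmon s n w + INR n * expmon s (pred n) w)%C = 0).
  { apply (is_Rderive_unique (fun t => pairing M (expmon t)) s).
    - apply is_Rderive_pairing_expmon.
    - apply (is_derive_ext_loc (V := C_R_NormedModule) (fun _ => RtoC 0)).
      + exists (mkposreal s Hs). intros t Ht. symmetry; apply H.
        apply Rabs_def2 in Ht. simpl in Ht. unfold minus, plus, opp in Ht; simpl in Ht. lra.
      + apply is_Rderive_const. }
  rewrite pairing_shift.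
  transitivity (pairing M (fun n w => (w * expmon s n w + INR n * expmon s (pred n) w)
     + - lam * expmon s n w)%C).
  - apply pairing_ext; intros; ring.
  - rewrite pairing_lin, D, (H s Hs). ring.
Qed.

Definition Ceq_dec (w z : C) : {w = z} + {w <> z} := excluded_middle_informative (w = z).

(* A right inverse of the transpose of [shift lam], up to the value at [(0, lam)]. *)
Fixpoint unshift (lam : C) (g : nat -> C -> C) (n : nat) (w : C) : C :=
  if Ceq_dec w lam then (g (S n) w / INR (S n))%C
  else match n with
       | O => (g O w / (w - lam))%C
       | S m => ((g (S m) w - INR (S m) * unshift lam g m w) / (w - lam))%C
       end.

Definition at_origin (lam : C) (n : nat) (w : C) : C :=
  match n with O => if Ceq_dec w lam then 1 else 0 | S _ => 0 end.

(** For w <> lam the system is triangular in n with diagonal w - lam, hence solvable upwards from n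
    = 0. For w = lam it reads n u(n-1) = g(n), which u(n) = g(n+1)/(n+1) solves for n > 0; the
    unsolvable equation at n = 0 leaves the defect [g O lam]. *)
Lemma unshift_spec (lam : C) (g : nat -> C -> C) (n : nat) (w : C) :
  ((w - lam) * unshift lam g n w + INR n * unshift lam g (pred n) w
   = g n w + - g O lam * at_origin lam n w)%C.
Proof.
  assert (HS : forall m, RtoC (INR (S m)) <> 0).
  { intros m E. apply RtoC_inj in E. apply (not_0_INR (S m)); [lia | exact E]. }
  destruct (Ceq_dec w lam) as [->|Hw].
  - destruct n as [|n]; cbn [pred unshift at_origin]; destruct (Ceq_dec lam lam); try easy.
    + simpl INR. field.
    + destruct n as [|n]; cbn [unshift]; destruct (Ceq_dec lam lam); try easy; field; split; auto.
  - assert (Hd : (w - lam)%C <> 0).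
    { intros E. apply Hw. replace w with ((w - lam) + lam)%C by ring. rewrite E. ring. }
    destruct n as [|n]; cbn [pred unshift at_origin]; destruct (Ceq_dec w lam); try easy.
    + simpl INR. field. exact Hd.
    + field. exact Hd.
Qed.

Lemma Cexp_neq_0 (u : C) : Cexp u <> 0.
Proof.
  intros E. assert (H : (Cexp u * Cexp (- u))%C = 1).
  { rewrite <- Cexp_plus. replace (u + - u)%C with (RtoC 0) by ring.
    unfold Cexp; simpl. rewrite exp_0, cos_0, sin_0. apply injective_projections; simpl; ring. }
  rewrite E, Cmult_0_l in H. apply RtoC_inj in H. lra.
Qed.

(** [l] lists, with multiplicity, the roots of a product of operators d/ds - lam that annihilates
    every term of [M]; [shift lam] uses up one root. The alternative a = 0 is there because [shift]
    keeps the terms whose coefficient it kills. *)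
Lemma expmon_free_aux (l : list C) (M : list (C * nat * C)) :
  (forall a n w, In (a, n, w) M -> a = 0 \/ (n < count_occ Ceq_dec l w)%nat) ->
  (forall s, 0 < s -> pairing M (expmon s) = 0) ->
  forall g, pairing M g = 0.
Proof.
  revert M; induction l as [|lam l IH]; intros M Hb Hv g.
  - unfold pairing. rewrite (Csum_ext _ _ (fun _ => 0 * 0)%C), Csum_scal; [ring |].
    intros [[a n] w] Ht. destruct (Hb a n w Ht) as [->|Hn]; [simpl; ring | simpl in Hn; lia].
  - assert (HS : forall h, pairing (shift lam M) h = 0).
    { apply IH; [| now apply shift_expmon_vanish].
      intros a n w Ht. apply in_flat_map in Ht as [[[a' n'] w'] [Ht Hin]].
      specialize (Hb _ _ _ Ht). cbn [fst snd] in Hin. simpl count_occ in Hb.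
      destruct Hin as [E|[E|[]]]; injection E as <- <- <-.
      - destruct Hb as [->|Hb]; [left; ring |].
        destruct (Ceq_dec lam w') as [->|_]; [left; ring | now right].
      - destruct Hb as [->|Hb]; [left; ring |].
        destruct n' as [|n']; [left; simpl; ring | right; simpl].
        destruct (Ceq_dec lam w'); lia. }
    (* [h] and the multiple [h O lam] of [at_origin lam] differ by a transposed shift of
       [unshift lam h], on which [M] vanishes; one unknown number remains. *)
    assert (HO : forall h, pairing M h = (h O lam * pairing M (at_origin lam))%C).
    { intros h. assert (E := HS (unshift lam h)). rewrite pairing_shift in E.
      rewrite (pairing_ext _ _ _ (unshift_spec lam h)), pairing_lin in E.
      replace (pairing M h) with
        (pairing M h + - h O lam * pairing M (at_origin lam) + h O lam * pairing M (at_origin lam))%C by ring.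
      rewrite E. ring. }
    (* The function [expmon 1] determines that number: its pairing is 0, while its value at (0, lam)
       is e^lam, which is not 0. *)
    rewrite HO. assert (E := Hv 1 Rlt_0_1). rewrite HO in E.
    destruct (Ceq_dec (pairing M (at_origin lam)) 0) as [E0|E0]; [rewrite E0; ring |].
    exfalso; revert E; apply Cmult_neq_0; [| exact E0].
    unfold expmon; simpl. rewrite Cmult_1_l. apply Cexp_neq_0.
Qed.

Lemma expmon_free (M : list (C * nat * C)) :
  (forall s, 0 < s -> pairing M (expmon s) = 0) -> forall g, pairing M g = 0.
Proof.
  assert (Hl : exists l, forall a n w, In (a, n, w) M -> a = 0 \/ (n < count_occ Ceq_dec l w)%nat).
  { induction M as [|[[a n] w] M [l IH]].
    - exists nil. intros a n w [].
    - exists (repeat w (S n) ++ l). intros a' n' w' [E|Ht].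
      + injection E as <- <- <-. right. rewrite count_occ_app, count_occ_repeat_eq by reflexivity. lia.
      + destruct (IH _ _ _ Ht) as [H|H]; [now left | right]. rewrite count_occ_app. lia. }
  destruct Hl as [l Hl]. now apply expmon_free_aux with l.
Qed.

(** * Integrals over the real line *)

Notation is_CInt := (is_RInt_gen (V := C_R_NormedModule)).

Lemma is_RInt_gen_antiderivative (f F : R -> R) (la lb : R) :
  (forall a b, is_RInt f a b (F b - F a)) ->
  filterlim F (Rbar_locally m_infty) (locally la) ->
  filterlim F (Rbar_locally p_infty) (locally lb) ->
  is_RInt_gen f (Rbar_locally m_infty) (Rbar_locally p_infty) (lb - la).
Proof.
  intros Hf Ha Hb P HP.
  assert (HF : filterlim (fun ab : R * R => F (snd ab) + - F (fst ab))
     (filter_prod (Rbar_locally m_infty) (Rbar_locally p_infty)) (locally (lb + - la))).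
  { apply (filterlim_comp_2 (F := filter_prod (Rbar_locally m_infty) (Rbar_locally p_infty))
      (fun ab => F (snd ab)) (fun ab => - F (fst ab)) Rplus (G := locally lb) (H := locally (- la))).
    - apply (filterlim_comp _ _ _ snd F _ (Rbar_locally p_infty)); [apply filterlim_snd | exact Hb].
    - apply (filterlim_comp _ _ _ (fun ab => F (fst ab)) Ropp _ (locally la)).
      + apply (filterlim_comp _ _ _ fst F _ (Rbar_locally m_infty)); [apply filterlim_fst | exact Ha].
      + apply (filterlim_opp (V := R_NormedModule)).
    - apply (filterlim_plus (V := R_NormedModule)). }
  unfold filtermapi. specialize (HF P HP). unfold filtermap in HF.
  revert HF; apply filter_imp. intros ab H. exists (F (snd ab) - F (fst ab)). now split.
Qed.

(** On one side of 0 the bound M/(1 + x^2) may be weakened to M/x^2, which has the primitive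
    -M/x. *)
Lemma RInt_tail_bound (f : R -> R) (M u v : R) :
  (forall x, continuous f x) -> (forall x, Rabs (f x) <= M / (1 + x ^ 2)) ->
  u <= v -> 0 < u \/ v < 0 -> Rabs (RInt f u v) <= M * (/ u - / v).
Proof.
  intros Hc Hb Huv Hs.
  assert (HM : 0 <= M).
  { specialize (Hb 0). replace (M / (1 + 0 ^ 2)) with M in Hb by (simpl; field).
    apply Rle_trans with (2 := Hb), Rabs_pos. }
  apply (norm_RInt_le (V := R_NormedModule) f (fun x => M * / x ^ 2) u v (RInt f u v) (M * (/ u - / v))).
  - exact Huv.
  - intros x Hx. change (norm (f x)) with (Rabs (f x)). apply Rle_trans with (1 := Hb x).
    apply Rmult_le_compat_l; [exact HM |].
    apply Rinv_le_contravar; [nra | lra].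
  - apply (RInt_correct (V := R_CompleteNormedModule)).
    apply (ex_RInt_continuous (V := R_CompleteNormedModule)). intros x _; apply Hc.
  - evar_last.
    + apply (is_RInt_derive (V := R_CompleteNormedModule) (fun x => - (M * / x)) (fun x => M * / x ^ 2)).
      * intros x Hx. rewrite Rmin_left, Rmax_right in Hx by exact Huv.
        assert (x <> 0) by lra. auto_derive; [assumption | field; assumption].
      * intros x Hx. rewrite Rmin_left, Rmax_right in Hx by exact Huv.
        assert (x <> 0) by lra.
        apply (ex_derive_continuous (V := R_NormedModule)). auto_derive. nra.
    + change (- (M * / v) - - (M * / u) = M * (/ u - / v)). ring.
Qed.

(** Cauchy criterion for [RInt f 0] at each end: beyond a point u of modulus above M/eps, every tail
    is at most M/|u| < eps. *)
Lemma ex_RInt_gen_bound (f : R -> R) (M : R) :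
  (forall x, continuous f x) -> (forall x, Rabs (f x) <= M / (1 + x ^ 2)) ->
  ex_RInt_gen f (Rbar_locally m_infty) (Rbar_locally p_infty).
Proof.
  intros Hc Hb.
  assert (HM : 0 <= M).
  { specialize (Hb 0). replace (M / (1 + 0 ^ 2)) with M in Hb by (simpl; field).
    apply Rle_trans with (2 := Hb), Rabs_pos. }
  assert (Hex : forall a b, ex_RInt f a b)
    by (intros; apply (ex_RInt_continuous (V := R_CompleteNormedModule)); intros x _; apply Hc).
  assert (HF : forall u v, RInt f 0 v - RInt f 0 u = RInt f u v).
  { intros u v. rewrite <- (RInt_Chasles f 0 u v) by apply Hex. unfold plus; simpl. ring. }
  assert (Htail : forall eps u v, 0 < eps -> u <= v ->
    (M / eps < u /\ 0 < u) \/ (v < - (M / eps) /\ v < 0) -> Rabs (RInt f u v) < eps).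
  { intros eps u v He Huv Hs. assert (Hme : M = M / eps * eps) by (field; lra).
    apply Rle_lt_trans with (1 := RInt_tail_bound f M u v Hc Hb Huv ltac:(lra)).
    destruct Hs as [[H1 H2]|[H1 H2]].
    - apply Rle_lt_trans with (M * / u).
      + apply Rmult_le_compat_l; [exact HM |]. assert (0 < / v) by (apply Rinv_0_lt_compat; lra). lra.
      + apply Rlt_div_l; [lra |]. nra.
    - apply Rle_lt_trans with (M * / - v).
      + apply Rmult_le_compat_l; [exact HM |]. rewrite Rinv_opp.
        assert (0 < / - u) by (apply Rinv_0_lt_compat; lra). rewrite Rinv_opp in H. lra.
      + apply Rlt_div_l; [lra |]. nra. }
  assert (Hsym : forall eps u v, 0 < eps ->
    (M / eps < u /\ 0 < u /\ M / eps < v /\ 0 < v) \/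
    (v < - (M / eps) /\ v < 0 /\ u < - (M / eps) /\ u < 0) ->
    ball (RInt f 0 u) eps (RInt f 0 v)).
  { intros eps u v He Hs. change (Rabs (RInt f 0 v - RInt f 0 u) < eps).
    destruct (Rle_dec u v) as [H|H].
    - rewrite HF. apply Htail; lra.
    - rewrite Rabs_minus_sym, HF. apply Htail; lra. }
  destruct (proj1 (filterlim_locally_cauchy (U := R_CompleteSpace) (F := Rbar_locally p_infty) (RInt f 0))) as [lb Hlb].
  { intros eps. exists (fun u => M / eps < u /\ 0 < u). split.
    - exists (Rmax (M / eps) 0). intros x Hx. split; eapply Rle_lt_trans; try apply Hx;
        [apply Rmax_l | apply Rmax_r].
    - intros u v Hu Hv. apply Hsym; [apply cond_pos | tauto]. }
  destruct (proj1 (filterlim_locally_cauchy (U := R_CompleteSpace) (F := Rbar_locally m_infty) (RInt f 0))) as [la Hla].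
  { intros eps. exists (fun u => u < - (M / eps) /\ u < 0). split.
    - exists (Rmin (- (M / eps)) 0). intros x Hx. split; eapply Rlt_le_trans; try apply Hx;
        [apply Rmin_l | apply Rmin_r].
    - intros u v Hu Hv. apply Hsym; [apply cond_pos | tauto]. }
  exists (lb - la). apply is_RInt_gen_antiderivative with (RInt f 0); try assumption.
  intros a b. rewrite HF. apply (RInt_correct (V := R_CompleteNormedModule)), Hex.
Qed.

(** Every set of the product filter contains a pair (-n, n), and over such an interval the integral
    y satisfies y = -y; so l is arbitrarily close to 0. *)
Lemma is_RInt_gen_odd (f : R -> R) (l : R) :
  (forall x, f (- x) = - f x) ->
  is_RInt_gen f (Rbar_locally m_infty) (Rbar_locally p_infty) l -> l = 0.
Proof.
  intros Hodd Hl.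
  apply Rabs_eq_0. apply Rle_antisym; [| apply Rabs_pos].
  apply le_epsilon. intros eps He. rewrite Rplus_0_l.
  destruct (Hl (ball l (mkposreal eps He)) (locally_ball l (mkposreal eps He))) as [Q S [A HQ] [B HS] HQS].
  set (n := Rmax (Rabs A) (Rabs B) + 1).
  assert (Hn : - n < A /\ B < n).
  { assert (H1 := Rmax_l (Rabs A) (Rabs B)). assert (H2 := Rmax_r (Rabs A) (Rabs B)).
    assert (H3 := Rle_abs (- A)). rewrite Rabs_Ropp in H3. assert (H4 := Rle_abs B).
    unfold n; lra. }
  destruct (HQS (- n) n (HQ _ (proj1 Hn)) (HS _ (proj2 Hn))) as [y [Hy Hball]]. simpl in Hy.
  assert (Hy' : is_RInt f (- n) n (- y)).
  { apply (is_RInt_swap (V := R_NormedModule)).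
    apply (is_RInt_ext (V := R_NormedModule) (fun x => opp (f (- x)))).
    - intros x _. rewrite Hodd. change (- - f x = f x). ring.
    - apply (is_RInt_comp_opp (V := R_NormedModule)). now rewrite Ropp_involutive. }
  assert (E : y = - y).
  { rewrite <- (is_RInt_unique _ _ _ _ Hy) at 1. now apply is_RInt_unique. }
  change (Rabs (y - l) < eps) in Hball. replace (y - l) with (- l) in Hball by lra.
  rewrite Rabs_Ropp in Hball. lra.
Qed.

Lemma is_CInt_pair (f : R -> C) (Fa Fb : (R -> Prop) -> Prop) (l : C) :
  Filter Fa -> Filter Fb ->
  is_CInt f Fa Fb l <->
  is_RInt_gen (fun x => Re (f x)) Fa Fb (Re l) /\ is_RInt_gen (fun x => Im (f x)) Fa Fb (Im l).
Proof.
  intros FFa FFb; split.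
  - intros H; split; intros P [eps HP].
    + destruct (H (fun y => P (Re y))) as [Q S HQ HS HQS].
      { exists eps. intros y [Hy _]. apply HP, Hy. }
      exists Q S; try assumption. intros a b Ha Hb. destruct (HQS a b Ha Hb) as [y [Hy Py]].
      exists (Re y); split; [| exact Py].
      apply (is_RInt_fct_extend_fst (U := R_NormedModule) (V := R_NormedModule) f), Hy.
    + destruct (H (fun y => P (Im y))) as [Q S HQ HS HQS].
      { exists eps. intros y [_ Hy]. apply HP, Hy. }
      exists Q S; try assumption. intros a b Ha Hb. destruct (HQS a b Ha Hb) as [y [Hy Py]].
      exists (Im y); split; [| exact Py].
      apply (is_RInt_fct_extend_snd (U := R_NormedModule) (V := R_NormedModule) f), Hy.
  - intros [H1 H2] P [eps HP].
    assert (B1 := H1 _ (locally_ball _ eps)). assert (B2 := H2 _ (locally_ball _ eps)).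
    unfold filtermapi in *. generalize (filter_and _ _ B1 B2). apply filter_imp.
    intros ab [[y1 [I1 P1]] [y2 [I2 P2]]]. exists (y1, y2). split.
    + now apply (is_RInt_fct_extend_pair (U := R_NormedModule) (V := R_NormedModule) f).
    + apply HP. now split.
Qed.

(** * Polynomial-Gaussian functions *)

Lemma is_RInt_gen_ext_eq {V : NormedModule R_AbsRing} (Fa Fb : (R -> Prop) -> Prop)
  (FFa : Filter Fa) (FFb : Filter Fb) (f g : R -> V) (l : V) :
  (forall x, f x = g x) -> is_RInt_gen f Fa Fb l -> is_RInt_gen g Fa Fb l.
Proof.
  intros H. apply is_RInt_gen_ext. apply filter_forall. intros ab x _; apply H.
Qed.

(** A class closed under products, conjugation, differentiation and powers of x, with decay built
    in. Membership alone settles integrability, vanishing boundary terms and the domain of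
    [hosc]. *)
Inductive gaussian : (R -> C) -> Prop :=
| gaussian_mono (a : C) (m : nat) (c : C) :
    Re c < 0 -> gaussian (fun x => a * RtoC x ^ m * gauss c x)%C
| gaussian_plus (f g : R -> C) :
    gaussian f -> gaussian g -> gaussian (fun x => f x + g x)%C.

Lemma gaussian_ext (f g : R -> C) : (forall x, f x = g x) -> gaussian f -> gaussian g.
Proof. intros H. now rewrite (functional_extensionality f g H). Qed.

Lemma gaussian_scal (a : C) (f : R -> C) : gaussian f -> gaussian (fun x => a * f x)%C.
Proof.
  induction 1 as [b m c Hc | f g _ IHf _ IHg].
  - apply gaussian_ext with (fun x => (a * b) * RtoC x ^ m * gauss c x)%C; [intros; ring |].
    now apply gaussian_mono.
  - apply gaussian_ext with (fun x => a * f x + a * g x)%C; [intros; ring |].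
    now apply gaussian_plus.
Qed.

Lemma gaussian_zero : gaussian (fun _ => RtoC 0).
Proof.
  apply gaussian_ext with (fun x => 0 * RtoC x ^ 0 * gauss (-1) x)%C; [intros; ring |].
  apply gaussian_mono. simpl. lra.
Qed.

Lemma gaussian_pow (k : nat) (f : R -> C) : gaussian f -> gaussian (fun x => RtoC x ^ k * f x)%C.
Proof.
  induction 1 as [b m c Hc | f g _ IHf _ IHg].
  - apply gaussian_ext with (fun x => b * RtoC x ^ (k + m) * gauss c x)%C.
    + intros; rewrite Cpow_add_r; ring.
    + now apply gaussian_mono.
  - apply gaussian_ext with (fun x => RtoC x ^ k * f x + RtoC x ^ k * g x)%C; [intros; ring |].
    now apply gaussian_plus.
Qed.

Lemma gauss_mult (c d : C) (x : R) : (gauss c x * gauss d x)%C = gauss (c + d) x.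
Proof. unfold gauss. rewrite <- Cexp_plus. f_equal. ring. Qed.

Lemma gauss_conj (c : C) (x : R) : Cconj (gauss c x) = gauss (Cconj c) x.
Proof.
  destruct c as [a b]; unfold gauss, Cexp, Cconj; simpl.
  replace (a * (x * (x * 1)) - - b * 0) with (a * (x * (x * 1)) - b * 0) by ring.
  replace (a * 0 + - b * (x * (x * 1))) with (- (a * 0 + b * (x * (x * 1)))) by ring.
  rewrite cos_neg, sin_neg. apply injective_projections; simpl; ring.
Qed.

Lemma gaussian_gauss_mult (d : C) (f : R -> C) :
  Re d < 0 -> gaussian f -> gaussian (fun x => gauss d x * f x)%C.
Proof.
  intros Hd; induction 1 as [b m c Hc | f g _ IHf _ IHg].
  - apply gaussian_ext with (fun x => b * RtoC x ^ m * gauss (d + c) x)%C.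
    + intros; rewrite <- gauss_mult; ring.
    + apply gaussian_mono. simpl. unfold Re in *. lra.
  - apply gaussian_ext with (fun x => gauss d x * f x + gauss d x * g x)%C; [intros; ring |].
    now apply gaussian_plus.
Qed.

Lemma gaussian_mult (f g : R -> C) : gaussian f -> gaussian g -> gaussian (fun x => f x * g x)%C.
Proof.
  intros Hf Hg; induction Hf as [b m c Hc | f f' _ IHf _ IHg].
  - apply gaussian_ext with (fun x => b * (RtoC x ^ m * (gauss c x * g x)))%C; [intros; ring |].
    now apply gaussian_scal, gaussian_pow, gaussian_gauss_mult.
  - apply gaussian_ext with (fun x => f x * g x + f' x * g x)%C; [intros; ring |].
    now apply gaussian_plus.
Qed.

Lemma gaussian_conj (f : R -> C) : gaussian f -> gaussian (fun x => Cconj (f x)).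
Proof.
  induction 1 as [b m c Hc | f g _ IHf _ IHg].
  - apply gaussian_ext with (fun x => Cconj b * RtoC x ^ m * gauss (Cconj c) x)%C.
    + intros x. rewrite !Cmult_conj, gauss_conj, Cpow_conj. do 3 f_equal.
      apply injective_projections; simpl; ring.
    + now apply gaussian_mono.
  - apply gaussian_ext with (fun x => Cconj (f x) + Cconj (g x))%C; [intros; now rewrite Cplus_conj |].
    now apply gaussian_plus.
Qed.

Lemma gaussian_is_derive (f : R -> C) :
  gaussian f -> exists f', gaussian f' /\ forall x, is_Rderive f x (f' x).
Proof.
  induction 1 as [a m c Hc | f g _ [f' [Hf Df]] _ [g' [Hg Dg]]].
  - exists (fun x => (a * INR m) * RtoC x ^ pred m * gauss c x
      + (a * (2 * c)) * RtoC x ^ (m + 1) * gauss c x)%C. split.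
    + apply gaussian_plus; now apply gaussian_mono.
    + intros x.
      replace ((a * INR m) * RtoC x ^ pred m * gauss c x
        + (a * (2 * c)) * RtoC x ^ (m + 1) * gauss c x)%C
      with ((a * (INR m * RtoC x ^ pred m)) * gauss c x
        + (a * RtoC x ^ m) * (2 * c * x * gauss c x))%C
      by (rewrite Cpow_add_r; simpl (RtoC x ^ 1)%C; ring).
      apply is_Rderive_mult; [apply is_Rderive_scal, is_Rderive_pow | apply is_Rderive_gauss].
  - exists (fun x => f' x + g' x)%C. split; [now apply gaussian_plus |].
    intros x; now apply is_Rderive_plus.
Qed.

Lemma gaussian_rderiv (f : R -> C) :
  gaussian f -> gaussian (rderiv f) /\ forall x, is_Rderive f x (rderiv f x).
Proof.
  intros Hf. destruct (gaussian_is_derive f Hf) as [f' [Hf' D]].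
  assert (E : rderiv f = f') by (apply functional_extensionality; intros; now apply rderiv_eq).
  now rewrite E.
Qed.

Lemma Cmod_Cexp (u : C) : Cmod (Cexp u) = exp (Re u).
Proof.
  unfold Cexp, Cmod. generalize (Re u) (Im u). intros a b; simpl fst; simpl snd.
  transitivity (sqrt (exp a ^ 2)); [f_equal | apply sqrt_pow2, Rlt_le, exp_pos].
  assert (H := sin2_cos2 b). unfold Rsqr in H.
  transitivity (exp a ^ 2 * (sin b * sin b + cos b * cos b)); [ring | rewrite H; ring].
Qed.

Lemma Cmod_gauss (c : C) (x : R) : Cmod (gauss c x) = exp (Re c * x ^ 2).
Proof.
  unfold gauss. rewrite Cmod_Cexp. f_equal. simpl. unfold Re. ring.
Qed.

(** Each factor 1 + t is paid for with half of the remaining rate: 1 + t <= (1 + 2/b)(1 + b t/2) <=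
    (1 + 2/b) e^(b t/2). *)
Lemma pow_le_exp (k : nat) (b : R) :
  0 < b -> exists K, forall t, 0 <= t -> (1 + t) ^ k <= K * exp (b * t).
Proof.
  revert b; induction k as [|k IH]; intros b Hb.
  - exists 1. intros t Ht. simpl. assert (H := exp_ineq1_le (b * t)). nra.
  - destruct (IH (b / 2)) as [K HK]; [lra |].
    assert (Hb2 : 0 < 2 / b) by (apply Rdiv_lt_0_compat; lra).
    exists ((1 + 2 / b) * K). intros t Ht. specialize (HK t Ht).
    assert (H : 1 + t <= (1 + 2 / b) * exp (b / 2 * t)).
    { apply Rle_trans with ((1 + 2 / b) * (1 + b / 2 * t)).
      - replace ((1 + 2 / b) * (1 + b / 2 * t)) with (1 + t + (2 / b + b / 2 * t)) by (field; lra).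
        assert (0 <= b / 2 * t) by (apply Rmult_le_pos; lra). lra.
      - apply Rmult_le_compat_l; [lra | apply exp_ineq1_le]. }
    replace (b * t) with (b / 2 * t + b / 2 * t) by field. rewrite exp_plus. simpl.
    replace ((1 + 2 / b) * K * (exp (b / 2 * t) * exp (b / 2 * t)))
      with (((1 + 2 / b) * exp (b / 2 * t)) * (K * exp (b / 2 * t))) by ring.
    apply Rmult_le_compat; try assumption; [lra | apply pow_le; lra].
Qed.

Lemma gaussian_bound (f : R -> C) :
  gaussian f -> exists M, forall x, Cmod (f x) <= M / (1 + x ^ 2).
Proof.
  induction 1 as [a m c Hc | f g _ [M HM] _ [N HN]].
  (* Of the m + 1 factors 1 + x^2, m dominate |x|^m and the last one pays for the denominator. *)
  - destruct (pow_le_exp (S m) (- Re c)) as [K HK]; [lra |].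
    exists (Cmod a * K). intros x.
    rewrite !Cmod_mult, Cmod_pow, Cmod_gauss, Cmod_R.
    assert (Hx : 0 <= x ^ 2) by apply pow2_ge_0.
    specialize (HK (x ^ 2) Hx).
    assert (Hp : 0 < 1 + x ^ 2) by lra.
    apply (Rle_div_r _ _ _ Hp).
    rewrite !Rmult_assoc. apply Rmult_le_compat_l; [apply Cmod_ge_0 |].
    assert (Hm : Rabs x ^ m <= (1 + x ^ 2) ^ m).
    { apply pow_incr. split; [apply Rabs_pos |]. rewrite <- (pow2_abs x).
      assert (H := pow2_ge_0 (Rabs x - 1 / 2)). nra. }
    assert (E : exp (Re c * x ^ 2) * exp (- Re c * x ^ 2) = 1).
    { rewrite <- exp_plus. replace (Re c * x ^ 2 + - Re c * x ^ 2) with 0 by ring. apply exp_0. }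
    assert (He := exp_pos (Re c * x ^ 2)).
    apply Rle_trans with ((1 + x ^ 2) ^ m * (exp (Re c * x ^ 2) * (1 + x ^ 2))).
    + apply Rmult_le_compat_r; [| exact Hm]. apply Rmult_le_pos; lra.
    + replace K with (exp (Re c * x ^ 2) * (K * exp (- Re c * x ^ 2)))
        by (transitivity (K * (exp (Re c * x ^ 2) * exp (- Re c * x ^ 2))); [ring | rewrite E; ring]).
      replace ((1 + x ^ 2) ^ m * (exp (Re c * x ^ 2) * (1 + x ^ 2)))
        with (exp (Re c * x ^ 2) * (1 + x ^ 2) ^ S m) by (simpl; ring).
      apply Rmult_le_compat_l; lra.
  - exists (M + N). intros x. apply Rle_trans with (1 := Cmod_triangle _ _).
    unfold Rdiv in *. rewrite Rmult_plus_distr_r. now apply Rplus_le_compat.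
Qed.

Lemma im_le_Cmod (c : C) : Rabs (Im c) <= Cmod c.
Proof. apply Rle_trans with (2 := Rmax_Cmod c), Rmax_r. Qed.

Lemma gaussian_is_RInt_gen (f : R -> C) :
  gaussian f ->
  is_CInt f (Rbar_locally m_infty) (Rbar_locally p_infty)
    (RInt_gen (V := C_R_CompleteNormedModule) f (Rbar_locally m_infty) (Rbar_locally p_infty)).
Proof.
  intros Hf.
  apply (RInt_gen_correct (V := C_R_CompleteNormedModule)).
  destruct (gaussian_bound f Hf) as [M HM]. destruct (gaussian_rderiv f Hf) as [_ D].
  assert (HR : ex_RInt_gen (fun x => Re (f x)) (Rbar_locally m_infty) (Rbar_locally p_infty)).
  { apply ex_RInt_gen_bound with M.
    - intros x. apply (ex_derive_continuous (V := R_NormedModule)). exists (Re (rderiv f x)).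
      apply (is_Rderive_pair f), D.
    - intros x. apply Rle_trans with (2 := HM x), re_le_Cmod. }
  assert (HI : ex_RInt_gen (fun x => Im (f x)) (Rbar_locally m_infty) (Rbar_locally p_infty)).
  { apply ex_RInt_gen_bound with M.
    - intros x. apply (ex_derive_continuous (V := R_NormedModule)). exists (Im (rderiv f x)).
      apply (is_Rderive_pair f), D.
    - intros x. apply Rle_trans with (2 := HM x), im_le_Cmod. }
  destruct HR as [u Hu], HI as [v Hv]. exists (u, v).
  now apply is_CInt_pair; try apply Rbar_locally_filter.
Qed.

Lemma gaussian_square_integrable (f : R -> C) : gaussian f -> square_integrable f.
Proof.
  intros Hf.
  assert (H := gaussian_is_RInt_gen _ (gaussian_mult _ _ Hf (gaussian_conj _ Hf))).
  apply is_CInt_pair in H as [H _]; try apply Rbar_locally_filter.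
  eexists. refine (is_RInt_gen_ext_eq _ _ _ _ _ _ _ _ H).
  intros x. rewrite <- Cmod2_conj. reflexivity.
Qed.

Lemma bound_filterlim (f : R -> R) (M : R) (a : Rbar) :
  a = m_infty \/ a = p_infty -> (forall x, Rabs (f x) <= M / (1 + x ^ 2)) ->
  filterlim f (Rbar_locally a) (locally 0).
Proof.
  intros Ha Hf P [eps HP].
  assert (He := cond_pos eps).
  assert (Hx : forall x, 1 < Rabs x -> M / eps < Rabs x -> P (f x)).
  { intros x H1 H2. apply HP. change (Rabs (f x - 0) < eps). rewrite Rminus_0_r.
    apply Rle_lt_trans with (1 := Hf x).
    assert (Hsq : 0 <= x ^ 2) by apply pow2_ge_0.
    assert (Hp : 0 < 1 + x ^ 2) by lra.
    apply (Rlt_div_l _ _ _ Hp).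
    assert (Hm : M = M / eps * eps) by (field; lra).
    assert (H3 : M / eps * eps < Rabs x * eps) by (apply Rmult_lt_compat_r; lra).
    assert (H4 : 0 < (Rabs x - 1) * (Rabs x * eps)) by (repeat apply Rmult_lt_0_compat; lra).
    rewrite <- pow2_abs. lra. }
  unfold filtermap. destruct Ha as [-> | ->].
  - exists (- Rmax 1 (M / eps)). intros x Hlt.
    assert (H1 := Rmax_l 1 (M / eps)). assert (H2 := Rmax_r 1 (M / eps)).
    apply Hx; rewrite Rabs_left; lra.
  - exists (Rmax 1 (M / eps)). intros x Hlt.
    assert (H1 := Rmax_l 1 (M / eps)). assert (H2 := Rmax_r 1 (M / eps)).
    apply Hx; rewrite Rabs_right; lra.
Qed.

(** Fundamental theorem: [f] is a primitive and tends to 0 at both ends. This supplies the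
    integration by parts behind the symmetry of [hosc]. *)
Lemma gaussian_RInt_rderiv (f : R -> C) :
  gaussian f -> is_CInt (rderiv f) (Rbar_locally m_infty) (Rbar_locally p_infty) (RtoC 0).
Proof.
  intros Hf. destruct (gaussian_bound f Hf) as [M HM].
  destruct (gaussian_rderiv f Hf) as [Hf' D]. destruct (gaussian_rderiv _ Hf') as [_ D'].
  assert (A : forall u v w : R -> R, (forall x, is_derive u x (v x)) ->
    (forall x, is_derive v x (w x)) -> (forall x, Rabs (u x) <= M / (1 + x ^ 2)) ->
    is_RInt_gen v (Rbar_locally m_infty) (Rbar_locally p_infty) 0).
  { intros u v w Du Dv Hu. replace 0 with (0 - 0) by ring.
    apply is_RInt_gen_antiderivative with u;
      try (apply bound_filterlim with M; [tauto | exact Hu]).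
    intros a b. apply (is_RInt_derive (V := R_CompleteNormedModule)); intros x _; [apply Du |].
    apply (ex_derive_continuous (V := R_NormedModule)). exists (w x). apply Dv. }
  apply is_CInt_pair; try apply Rbar_locally_filter. split.
  - apply A with (fun x => Re (f x)) (fun x => Re (rderiv (rderiv f) x)).
    + intros x. apply (is_Rderive_pair f), D.
    + intros x. apply (is_Rderive_pair (rderiv f)), D'.
    + intros x. apply Rle_trans with (2 := HM x), re_le_Cmod.
  - apply A with (fun x => Im (f x)) (fun x => Im (rderiv (rderiv f) x)).
    + intros x. apply (is_Rderive_pair f), D.
    + intros x. apply (is_Rderive_pair (rderiv f)), D'.
    + intros x. apply Rle_trans with (2 := HM x), im_le_Cmod.
Qed.

Notation is_ip f g l := (is_CInt (fun x => Cconj (f x) * g x)%C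
  (Rbar_locally m_infty) (Rbar_locally p_infty) l).

Lemma gaussian_ip (f g : R -> C) : gaussian f -> gaussian g -> is_ip f g (ip f g).
Proof. intros Hf Hg. now apply gaussian_is_RInt_gen, gaussian_mult; [apply gaussian_conj |]. Qed.

Lemma is_ip_unique (f g : R -> C) (l : C) : is_ip f g l -> ip f g = l.
Proof.
  apply (is_RInt_gen_unique (V := C_R_CompleteNormedModule)).
Qed.

Lemma ip_conj (f g : R -> C) : gaussian f -> gaussian g -> Cconj (ip f g) = ip g f.
Proof.
  intros Hf Hg. symmetry; apply is_ip_unique.
  assert (H := gaussian_ip f g Hf Hg).
  apply is_CInt_pair in H as [H1 H2]; try apply Rbar_locally_filter.
  apply is_CInt_pair; try apply Rbar_locally_filter. split.
  - refine (is_RInt_gen_ext_eq _ _ _ _ _ _ _ _ H1). intros x. simpl. ring.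
  - refine (is_RInt_gen_ext_eq _ _ _ _ _ _ _ _ (is_RInt_gen_opp (V := R_NormedModule) _ _ H2)).
    intros x. simpl. unfold opp; simpl. ring.
Qed.

Lemma ip_plus_r (f g h : R -> C) :
  gaussian f -> gaussian g -> gaussian h -> ip f (fadd g h) = (ip f g + ip f h)%C.
Proof.
  intros Hf Hg Hh. apply is_ip_unique.
  refine (is_RInt_gen_ext_eq (V := C_R_NormedModule) _ _ _ _
    (fun x => plus (Cconj (f x) * g x)%C (Cconj (f x) * h x)%C) _ _ _ _).
  - intros x. change (Cconj (f x) * g x + Cconj (f x) * h x = Cconj (f x) * (g x + h x))%C. ring.
  - apply (is_RInt_gen_plus (V := C_R_NormedModule)); now apply gaussian_ip.
Qed.

Lemma ip_scal_r (a : C) (f g : R -> C) :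
  gaussian f -> gaussian g -> ip f (fscal a g) = (a * ip f g)%C.
Proof.
  intros Hf Hg. apply is_ip_unique.
  assert (H := gaussian_ip f g Hf Hg).
  apply is_CInt_pair in H as [H1 H2]; try apply Rbar_locally_filter.
  apply is_CInt_pair; try apply Rbar_locally_filter. split.
  - evar_last; [| reflexivity].
    refine (is_RInt_gen_ext_eq _ _ _ _ _ _ _ _ (is_RInt_gen_minus (V := R_NormedModule) _ _ _ _
        (is_RInt_gen_scal (V := R_NormedModule) _ (Re a) _ H1)
        (is_RInt_gen_scal (V := R_NormedModule) _ (Im a) _ H2))).
    intros x. unfold fscal, minus, plus, opp, scal, mult; simpl.
    unfold mult; simpl; unfold Re, Im. ring.
  - evar_last; [| reflexivity].
    refine (is_RInt_gen_ext_eq _ _ _ _ _ _ _ _ (is_RInt_gen_plus (V := R_NormedModule) _ _ _ _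
        (is_RInt_gen_scal (V := R_NormedModule) _ (Re a) _ H2)
        (is_RInt_gen_scal (V := R_NormedModule) _ (Im a) _ H1))).
    intros x. unfold fscal, minus, plus, opp, scal, mult; simpl.
    unfold mult; simpl; unfold Re, Im. ring.
Qed.

Lemma ip_plus_l (f g h : R -> C) :
  gaussian f -> gaussian g -> gaussian h -> ip (fadd g h) f = (ip g f + ip h f)%C.
Proof.
  intros Hf Hg Hh.
  rewrite <- (ip_conj f), ip_plus_r, Cplus_conj, !ip_conj; try assumption; [reflexivity |].
  now apply gaussian_plus.
Qed.

Lemma ip_scal_l (a : C) (f g : R -> C) :
  gaussian f -> gaussian g -> ip (fscal a g) f = (Cconj a * ip g f)%C.
Proof.
  intros Hf Hg.
  rewrite <- (ip_conj f), ip_scal_r, Cmult_conj, !ip_conj; try assumption; [reflexivity |].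
  now apply gaussian_scal.
Qed.

Lemma ip_parity (f g : R -> C) :
  (forall x : R, (Cconj (f (- x)%R) * g (- x)%R = - (Cconj (f x) * g x))%C) ->
  gaussian f -> gaussian g -> ip f g = 0.
Proof.
  intros Hodd Hf Hg. assert (H := gaussian_ip f g Hf Hg).
  apply is_CInt_pair in H as [H1 H2]; try apply Rbar_locally_filter.
  apply is_RInt_gen_odd in H1; [| intros x; now rewrite Hodd].
  apply is_RInt_gen_odd in H2; [| intros x; now rewrite Hodd].
  apply injective_projections; assumption.
Qed.

Lemma gaussian_hosc (f : R -> C) : gaussian f -> gaussian (hosc f).
Proof.
  intros Hf. apply gaussian_rderiv in Hf as Hf'. destruct Hf' as [Hf' _].
  apply gaussian_rderiv in Hf' as [Hf'' _].
  apply gaussian_scal, gaussian_plus.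
  - apply gaussian_ext with (fun x => - (1) * rderiv (rderiv f) x)%C; [intros; ring |].
    now apply gaussian_scal.
  - apply gaussian_ext with (fun x => RtoC x ^ 2 * f x)%C; [intros; now rewrite RtoC_pow |].
    now apply gaussian_pow.
Qed.

(* The difference of the two integrands is the derivative of the Wronskian of [conj f] and [g]. *)
Lemma ip_hosc (f g : R -> C) :
  gaussian f -> gaussian g -> ip (hosc f) g = ip f (hosc g).
Proof.
  intros Hf Hg.
  destruct (gaussian_rderiv f Hf) as [Hf1 Df]. destruct (gaussian_rderiv _ Hf1) as [Hf2 Df1].
  destruct (gaussian_rderiv g Hg) as [Hg1 Dg]. destruct (gaussian_rderiv _ Hg1) as [Hg2 Dg1].
  set (W := fun x => (- (1 / 2) * (Cconj (rderiv f x) * g x) + 1 / 2 * (Cconj (f x) * rderiv g x))%C).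
  assert (HW : gaussian W).
  { apply gaussian_plus; apply gaussian_scal, gaussian_mult; try assumption; now apply gaussian_conj. }
  assert (DW : forall x, rderiv W x = (Cconj (hosc f x) * g x - Cconj (f x) * hosc g x)%C).
  { intros x. apply rderiv_eq. evar_last.
    - exact (is_Rderive_plus _ _ _ _ _
        (is_Rderive_scal (- (1 / 2)) _ _ _
          (is_Rderive_mult _ _ _ _ _ (is_Rderive_conj _ _ _ (Df1 x)) (Dg x)))
        (is_Rderive_scal (1 / 2) _ _ _
          (is_Rderive_mult _ _ _ _ _ (is_Rderive_conj _ _ _ (Df x)) (Dg1 x)))).
    - unfold hosc. rewrite !Cmult_conj, Cplus_conj, Copp_conj, Cmult_conj.
      replace (Cconj (RtoC (1 / 2))) with (1 / 2)%C
        by (rewrite <- RtoC_div by lra; apply injective_projections; simpl; ring).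
      replace (Cconj (RtoC (x ^ 2))) with (RtoC (x ^ 2)) by (apply injective_projections; simpl; ring).
      rewrite RtoC_div by lra. ring. }
  apply is_ip_unique.
  refine (is_RInt_gen_ext_eq (V := C_R_NormedModule) _ _ _ _
    (fun x => plus (Cconj (f x) * hosc g x)%C (rderiv W x)) _ _ _ _).
  - intros x. rewrite DW.
    change (Cconj (f x) * hosc g x + (Cconj (hosc f x) * g x - Cconj (f x) * hosc g x)
      = Cconj (hosc f x) * g x)%C. ring.
  - evar_last.
    + apply (is_RInt_gen_plus (V := C_R_NormedModule)).
      * apply gaussian_ip; [exact Hf | now apply gaussian_hosc].
      * now apply gaussian_RInt_rderiv.
    + apply Cplus_0_r.
Qed.

Lemma gaussian_D_hosc (f : R -> C) : gaussian f -> D_hosc f.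
Proof.
  intros Hf. destruct (gaussian_rderiv f Hf) as [Hf1 Df]. destruct (gaussian_rderiv _ Hf1) as [Hf2 Df1].
  split; [split; intros x; eexists; [apply Df | apply Df1] |].
  repeat split; try now apply gaussian_square_integrable.
  apply gaussian_square_integrable.
  apply gaussian_ext with (fun x => RtoC x ^ 2 * f x)%C; [intros; now rewrite RtoC_pow |].
  now apply gaussian_pow.
Qed.

(** * The graph of the operators S^ and S^* *)

Definition Scoef (z : C) (k : nat) : C := (Ci / 2 * Lcoef z k)%C.

(* [S_graph b f g]: [f] lies in N_0 ([b = false]) or N_1 ([b = true]), and [g] is its image under
   the linear extension of S^ or S^*, which is not yet known to be single-valued. *)
Inductive S_graph (b : bool) : (R -> C) -> (R -> C) -> Prop :=
| S_graph_wave (n : nat) (z : C) :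
    valid_z z -> S_graph b (wave b n delta0 z) (wave b n (Scoef z) z)
| S_graph_zero : S_graph b fzero fzero
| S_graph_lin (a : C) (f g f' g' : R -> C) :
    S_graph b f g -> S_graph b f' g' ->
    S_graph b (fadd f (fscal a f')) (fadd g (fscal a g')).

Lemma S_graph_ext (b : bool) (f g f' g' : R -> C) :
  (forall x, f x = f' x) -> (forall x, g x = g' x) -> S_graph b f g -> S_graph b f' g'.
Proof.
  intros Hf Hg. now rewrite (functional_extensionality f f' Hf), (functional_extensionality g g' Hg).
Qed.

Lemma gaussian_fadd (f g : R -> C) : gaussian f -> gaussian g -> gaussian (fadd f g).
Proof. apply gaussian_plus. Qed.

Lemma gaussian_fscal (a : C) (f : R -> C) : gaussian f -> gaussian (fscal a f).
Proof. apply gaussian_scal. Qed.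

Lemma gaussian_wave (b : bool) (n : nat) (c : nat -> C) (z : C) :
  valid_z z -> gaussian (wave b n c z).
Proof.
  intros [Hz _]; revert c; induction n as [|n IH]; intros c.
  - unfold wave. rewrite xi_gauss.
    apply gaussian_ext with (fun x => c O * RtoC x ^ (if b then 1 else 0) * gauss (Ci * z / 2) x)%C.
    + intros x. destruct b; simpl; ring.
    + apply gaussian_mono.
      replace (Re (Ci * z / 2)%C) with (- (Im z / 2)); [lra |].
      destruct z as [u v]. simpl. field.
  - apply gaussian_ext with
      (fun x => RtoC x ^ 2 * wave b n c z x + wave b n (fun k => c (S k)) z x)%C.
    + intros x. unfold wave. cbn [umbral]. rewrite <- RtoC_pow. ring.
    + apply gaussian_plus; [apply gaussian_pow |]; apply IH.
Qed.

Lemma S_graph_gaussian (b : bool) (f g : R -> C) : S_graph b f g -> gaussian f /\ gaussian g.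
Proof.
  induction 1 as [n z Hz | | a f g f' g' _ [IH1 IH2] _ [IH3 IH4]].
  - split; now apply gaussian_wave.
  - split; apply gaussian_zero.
  - split; apply gaussian_fadd; try apply gaussian_fscal; assumption.
Qed.

Lemma hosc_lin (a : C) (f g : R -> C) :
  gaussian f -> gaussian g ->
  hosc (fadd f (fscal a g)) = fadd (hosc f) (fscal a (hosc g)).
Proof.
  intros Hf Hg.
  assert (D : forall u v, gaussian u -> gaussian v ->
    rderiv (fadd u (fscal a v)) = fadd (rderiv u) (fscal a (rderiv v))).
  { intros u v Hu Hv. apply functional_extensionality; intros x. apply rderiv_eq.
    apply (is_Rderive_plus u); [| apply (is_Rderive_scal a v)]; now apply gaussian_rderiv. }
  apply functional_extensionality; intros x. unfold hosc.
  rewrite (D f g), (D (rderiv f) (rderiv g)); try assumption; try now apply gaussian_rderiv.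
  unfold fadd, fscal. ring.
Qed.

Lemma hosc_zero : hosc fzero = fzero.
Proof.
  assert (D : rderiv fzero = fzero).
  { apply functional_extensionality; intros x. apply rderiv_eq, is_Rderive_const. }
  apply functional_extensionality; intros x. unfold hosc. rewrite !D. unfold fzero. ring.
Qed.

(* The commutation relation [S h - h S = i]. *)
Lemma S_graph_hosc (b : bool) (f g : R -> C) :
  S_graph b f g -> S_graph b (hosc f) (fadd (hosc g) (fscal Ci f)).
Proof.
  induction 1 as [n z Hz | | a f g f' g' H1 IH1 H2 IH2].
  - set (k := if b then RtoC 3 else RtoC 1).
    (* The weights are the coefficients of [hosc] on s^n xi_z, from the outside in for s^(n-1), s^n
       and s^(n+1); at n = 0, where [pred n] is n, the outermost weight is zero. *)
    apply (fun F G HF HG => S_graph_ext b _ _ F G HF HG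
      (S_graph_lin b (- (2 * k * INR n + 4 * (INR n * INR (pred n))) / 2) _ _ _ _
        (S_graph_lin b (- ((4 * INR n + k) * Ci * z) / 2) _ _ _ _
        (S_graph_lin b ((1 + z * z) / 2) _ _ _ _ (S_graph_zero b)
          (S_graph_wave b (S n) z Hz)) (S_graph_wave b n z Hz)) (S_graph_wave b (pred n) z Hz))%C).
    + intros x. rewrite hosc_wave. fold k. unfold fadd, fscal, fzero, wave. rewrite !umbral_delta0.
      destruct n as [|[|n]]; cbn [pred]; rewrite ?Cpow_S; simpl INR; field.
    + intros x. unfold fadd, fscal, fzero. rewrite hosc_wave. fold k. unfold wave.
      assert (E : forall m, umbral m (Scoef z) (RtoC (x ^ 2)) =
        (Ci / 2 * umbral m (Lcoef z) (RtoC (x ^ 2)))%C).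
      { intros m. transitivity (umbral m (fun j => Ci / 2 * Lcoef z j + 0)%C (RtoC (x ^ 2))).
        - apply umbral_ext; intros j. unfold Scoef. ring.
        - rewrite umbral_lin, umbral_zero. ring. }
      rewrite !E, umbral_delta0.
      (* The terms with the parity constant [k] agree on both sides and cancel, so one recurrence
         serves both S^ and S^*; its right-hand side 4 s^n, times i/4, is the term i f. *)
      assert (H := umbral_Lcoef_rec n z (RtoC (x ^ 2)) Hz).
      replace (RtoC (x ^ 2) ^ n)%C with (1 / 4 * (4 * RtoC (x ^ 2) ^ n))%C by field.
      rewrite <- H. field.
  - rewrite hosc_zero. refine (S_graph_ext b _ _ _ _ _ _ (S_graph_zero b)); [reflexivity |].
    intros x. unfold fadd, fscal, fzero. ring.
  - destruct (S_graph_gaussian b f g H1) as [Gf Gg].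
    destruct (S_graph_gaussian b f' g' H2) as [Gf' Gg'].
    rewrite !hosc_lin by assumption.
    refine (S_graph_ext b _ _ _ _ _ _ (S_graph_lin b a _ _ _ _ IH1 IH2)); [reflexivity |].
    intros x. unfold fadd, fscal. ring.
Qed.

(** The third entry of a triple is w = i z/2, so that xi_z is e^(w x^2) and z = -2 i w. A single
    list describes both members of the pair; only the function that it is paired with changes. *)
Lemma S_graph_pairing (b : bool) (f g : R -> C) :
  S_graph b f g -> exists M, forall x,
    f x = pairing M (fun n w => wave b n delta0 (- (2) * Ci * w)%C x) /\
    g x = pairing M (fun n w => wave b n (Scoef (- (2) * Ci * w)%C) (- (2) * Ci * w)%C x).
Proof.
  induction 1 as [n z Hz | | a f g f' g' _ [M HM] _ [N HN]].
  - exists ((RtoC 1, n, (Ci * z / 2)%C) :: nil). intros x. unfold pairing, Csum; simpl fold_right.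
    replace (- (2) * Ci * (Ci * z / 2))%C with z
      by (transitivity (- (Ci * Ci) * z)%C; [rewrite Ci_sqr; ring | field]).
    split; ring.
  - exists nil. intros x. split; reflexivity.
  - exists (M ++ map (fun t => (a * fst (fst t), snd (fst t), snd t)%C) N). intros x.
    destruct (HM x) as [Hf Hg], (HN x) as [Hf' Hg'].
    assert (E : forall h, pairing (map (fun t => (a * fst (fst t), snd (fst t), snd t)%C) N) h
      = (a * pairing N h)%C).
    { intros h. unfold pairing. rewrite map_map, <- Csum_scal.
      apply Csum_ext; intros t _. simpl. ring. }
    unfold fadd, fscal. rewrite !pairing_app, !E, Hf, Hg, Hf', Hg'. now split.
Qed.

(** At x = sqrt s > 0 the factor x of the odd case can be divided out, so sum a s^n e^(w s) vanishes
    for s > 0. Independence then applies with the images at a fixed point as the function of (n,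
    w). *)
Lemma S_graph_zero_unique (b : bool) (g : R -> C) : S_graph b fzero g -> g = fzero.
Proof.
  intros H. destruct (S_graph_pairing b _ _ H) as [M HM].
  apply functional_extensionality; intros x. rewrite (proj2 (HM x)).
  apply expmon_free. intros s Hs.
  assert (Hr := sqrt_lt_R0 s Hs).
  assert (Ho : oddfac b (sqrt s) <> 0).
  { destruct b; simpl; intros E; apply RtoC_inj in E; lra. }
  assert (E : (oddfac b (sqrt s) * pairing M (expmon s) = 0)%C).
  { transitivity (fzero (sqrt s)); [| reflexivity]. rewrite (proj1 (HM (sqrt s))).
    unfold pairing. rewrite <- Csum_scal. apply Csum_ext. intros [[a n] w] _. simpl fst; simpl snd.
    unfold wave, expmon, xi. rewrite umbral_delta0, pow2_sqrt by lra.
    replace (Ci * (- (2) * Ci * w) * RtoC (s / 2))%C with (w * s)%C; [ring |].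
    rewrite RtoC_div by lra. transitivity (- (Ci * Ci) * (w * s))%C; [rewrite Ci_sqr; ring | field]. }
  destruct (Ceq_dec (pairing M (expmon s)) 0) as [E0|E0]; [exact E0 |].
  now apply Cmult_neq_0 in E.
Qed.

Lemma S_graph_unique (b : bool) (f g g' : R -> C) : S_graph b f g -> S_graph b f g' -> g = g'.
Proof.
  intros H H'.
  assert (E : fadd g (fscal (- (1)) g') = fzero).
  { apply (S_graph_zero_unique b).
    apply (S_graph_ext b (fadd f (fscal (- (1)) f)) (fadd g (fscal (- (1)) g'))); [| reflexivity |].
    - intros x. unfold fadd, fscal, fzero. ring.
    - now apply S_graph_lin. }
  apply functional_extensionality; intros x.
  apply (f_equal (fun h => h x)) in E. unfold fadd, fscal, fzero in E.
  replace (g x) with (g x + - (1) * g' x + g' x)%C by ring. rewrite E. ring.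
Qed.

Lemma S_graph_parity (b : bool) (f g : R -> C) :
  S_graph b f g -> forall x, f (- x) = ((if b then - (1) else 1) * f x)%C.
Proof.
  induction 1 as [n z Hz | | a f g f' g' _ IH1 _ IH2]; intros x.
  - unfold wave, xi. replace ((- x) ^ 2) with (x ^ 2) by ring.
    destruct b; simpl oddfac; rewrite ?RtoC_opp; ring.
  - unfold fzero. ring.
  - unfold fadd, fscal. rewrite IH1, IH2. ring.
Qed.

(** * The form [that] *)

Lemma S_graph_sum (b : bool) (c : nat -> C) (z : C) (l : list nat) :
  valid_z z ->
  S_graph b (fun x => Csum (map (fun n => c n * wave b n delta0 z x)%C l))
    (fun x => Csum (map (fun n => c n * wave b n (Scoef z) z x)%C l)).
Proof.
  intros Hz; induction l as [|n l IH].
  - apply S_graph_zero.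
  - refine (S_graph_ext b _ _ _ _ _ _ (S_graph_lin b (c n) _ _ _ _ IH (S_graph_wave b n z Hz)));
      intros x; unfold fadd, fscal; cbn [map]; rewrite Csum_cons; ring.
Qed.

Lemma S_graph_gen (g : gen) : valid_z (g_z g) -> S_graph (g_odd g) (gen_fun g) (gen_S g).
Proof.
  destruct g as [rho z b]; simpl; intros Hz.
  refine (S_graph_ext b _ _ _ _ _ _ (S_graph_sum b (fun n => nth n rho (RtoC 0)) z
    (seq 0 (length rho)) Hz)); intros x.
  - unfold gen_fun, poly_eval_sq, g_rho, g_odd, g_z.
    transitivity (oddfac b x * xi z x * Csum (map (fun n => nth n rho (RtoC 0) *
      RtoC ((x ^ 2) ^ n)) (seq 0 (length rho))))%C; [| ring].
    rewrite <- Csum_scal. apply Csum_ext; intros n _. unfold wave.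
    rewrite umbral_delta0, (RtoC_pow (x ^ 2)). ring.
  - unfold gen_S, rhoL, g_rho, g_odd, g_z.
    transitivity (Ci / 2 * oddfac b x * xi z x * Csum (map (fun n => nth n rho (RtoC 0) *
      tL n x z) (seq 0 (length rho))))%C; [| ring].
    rewrite <- Csum_scal. apply Csum_ext; intros n _. unfold wave. rewrite tL_umbral.
    replace (umbral n (Scoef z) (RtoC (x ^ 2))) with (Ci / 2 * umbral n (Lcoef z) (RtoC (x ^ 2)))%C;
      [ring |].
    transitivity (umbral n (fun j => Ci / 2 * Lcoef z j + 0)%C (RtoC (x ^ 2))).
    + rewrite umbral_lin, umbral_zero. ring.
    + apply umbral_ext; intros j. unfold Scoef. ring.
Qed.

Definition part (b : bool) (F : formal) : formal := if b then odd_part F else even_part F.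

Lemma S_graph_part (b : bool) (F : formal) :
  valid F -> S_graph b (realize (part b F)) (Sreal (part b F)).
Proof.
  induction 1 as [|g F Hg HF IH].
  - destruct b; apply S_graph_zero.
  - assert (G := S_graph_gen g Hg).
    destruct g as [rho z b']; simpl in Hg.
    destruct b, b'; simpl in *; try exact IH;
      (refine (S_graph_ext _ _ _ _ _ _ _ (S_graph_lin _ 1 _ _ _ _ IH G));
       intros x; unfold fadd, fscal, realize, Sreal; cbn [map]; rewrite Csum_cons; ring).
Qed.

Lemma realize_parts (F : formal) :
  realize F = fadd (realize (part false F)) (realize (part true F)) /\
  Sreal F = fadd (Sreal (part false F)) (Sreal (part true F)).
Proof.
  assert (H : forall v : gen -> C, Csum (map v F) =
     (Csum (map v (part false F)) + Csum (map v (part true F)))%C).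
  { intros v. induction F as [|g F IH]; [unfold Csum; simpl; ring |].
    cbn [map]. rewrite Csum_cons, IH. destruct g as [rho z b].
    unfold part, even_part, odd_part. destruct b; cbn [filter g_odd negb map];
      rewrite Csum_cons; ring. }
  split; apply functional_extensionality; intros x;
    [apply (H (fun g => gen_fun g x)) | apply (H (fun g => gen_S g x))].
Qed.

(** Directness of the sum of N_0 and N_1: f(x) + f(-x) and f(x) - f(-x) recover the two
    components. *)
Lemma parity_unique (f0 g0 f1 g1 k0 l0 k1 l1 : R -> C) :
  S_graph false f0 g0 -> S_graph true f1 g1 -> S_graph false k0 l0 -> S_graph true k1 l1 ->
  fadd f0 f1 = fadd k0 k1 -> f0 = k0 /\ f1 = k1.
Proof.
  intros H0 H1 H2 H3 E.
  assert (A : forall x, (f0 x = k0 x /\ f1 x = k1 x)%C).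
  { intros x. assert (E1 := f_equal (fun u => u x) E). assert (E2 := f_equal (fun u => u (- x)) E).
    unfold fadd in E1, E2. simpl in E1, E2.
    rewrite (S_graph_parity _ _ _ H0), (S_graph_parity _ _ _ H1), (S_graph_parity _ _ _ H2),
      (S_graph_parity _ _ _ H3) in E2.
    split.
    - transitivity (1 / 2 * ((f0 x + f1 x) + (1 * f0 x + - (1) * f1 x)))%C; [field |].
      rewrite E1, E2. field.
    - transitivity (1 / 2 * ((f0 x + f1 x) - (1 * f0 x + - (1) * f1 x)))%C; [field |].
      rewrite E1, E2. field. }
  split; apply functional_extensionality; intros x; apply A.
Qed.

(** It frees the form from the choice made by [rep]: whatever representation is picked, its parts
    and their images are already determined by the function. *)
Lemma formal_parts_unique (F : formal) (f0 g0 f1 g1 : R -> C) :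
  valid F -> S_graph false f0 g0 -> S_graph true f1 g1 -> realize F = fadd f0 f1 ->
  (realize (part false F) = f0 /\ Sreal (part false F) = g0) /\
  (realize (part true F) = f1 /\ Sreal (part true F) = g1).
Proof.
  intros HF H0 H1 E. rewrite (proj1 (realize_parts F)) in E.
  assert (P0 := S_graph_part false F HF). assert (P1 := S_graph_part true F HF).
  destruct (parity_unique _ _ _ _ _ _ _ _ P0 P1 H0 H1 E) as [E0 E1].
  rewrite E0 in *. rewrite E1 in *.
  repeat split; [exact (S_graph_unique _ _ _ _ P0 H0) | exact (S_graph_unique _ _ _ _ P1 H1)].
Qed.

Lemma Sreal_well_defined (F G : formal) :
  valid F -> valid G -> realize F = realize G -> Sreal F = Sreal G.
Proof.
  intros HF HG E. rewrite (proj1 (realize_parts G)) in E.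
  destruct (formal_parts_unique F _ _ _ _ HF (S_graph_part false G HG) (S_graph_part true G HG) E)
    as [[_ E0] [_ E1]].
  now rewrite (proj2 (realize_parts F)), (proj2 (realize_parts G)), E0, E1.
Qed.

Lemma InN_plus (f g : R -> C) : InN f -> InN g -> InN (fadd f g).
Proof.
  intros [F [HF <-]] [G [HG <-]]. exists (F ++ G). split.
  - now apply Forall_app.
  - apply functional_extensionality; intros x. unfold realize. now rewrite map_app, Csum_app.
Qed.

Lemma InN_scal (a : C) (f : R -> C) : InN f -> InN (fscal a f).
Proof.
  intros [F [HF <-]].
  exists (map (fun g => Gen (map (Cmult a) (g_rho g)) (g_z g) (g_odd g)) F). split.
  - apply Forall_map. exact HF.
  - apply functional_extensionality; intros x. unfold fscal, realize. rewrite map_map, <- Csum_scal.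
    apply Csum_ext; intros [rho z b] _. unfold gen_fun, poly_eval_sq; simpl. rewrite length_map.
    rewrite !Cmult_assoc. do 2 f_equal. rewrite <- Csum_scal. apply Csum_ext; intros n Hn.
    replace (RtoC 0) with (a * 0)%C at 1 by ring. rewrite map_nth. ring.
Qed.

Lemma InN_zero : InN fzero.
Proof. exists nil. split; [constructor | reflexivity]. Qed.

Lemma InN_wave (b : bool) (n : nat) (z : C) : valid_z z -> InN (wave b n delta0 z).
Proof.
  intros Hz. exists (Gen (repeat (RtoC 0) n ++ RtoC 1 :: nil) z b :: nil). split.
  - constructor; [exact Hz | constructor].
  - apply functional_extensionality; intros x. unfold realize, gen_fun, poly_eval_sq, wave; simpl.
    rewrite length_app, repeat_length, Nat.add_comm. cbn [Nat.add length].
    rewrite seq_S, map_app, Csum_app.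
    rewrite (Csum_ext _ _ (fun _ => 0 * 0)%C (seq 0 n)), Csum_scal.
    + cbn [map]. rewrite !Csum_cons. simpl (0 + n)%nat.
      rewrite app_nth2, repeat_length, Nat.sub_diag by (rewrite repeat_length; lia).
      rewrite umbral_delta0, RtoC_pow. unfold Csum; simpl. ring.
    + intros k Hk; apply in_seq in Hk.
      rewrite app_nth1, nth_repeat by (rewrite repeat_length; lia). ring.
Qed.

Lemma S_graph_InN (b : bool) (f g : R -> C) : S_graph b f g -> InN f.
Proof.
  induction 1 as [n z Hz | | a f g f' g' _ IH1 _ IH2].
  - now apply InN_wave.
  - apply InN_zero.
  - now apply InN_plus; [| apply InN_scal].
Qed.

Lemma InN_split (f : R -> C) :
  InN f -> exists f0 g0 f1 g1,
    S_graph false f0 g0 /\ S_graph true f1 g1 /\ f = fadd f0 f1.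
Proof.
  intros [F [HF <-]].
  exists (realize (part false F)), (Sreal (part false F)), (realize (part true F)), (Sreal (part true F)).
  split; [now apply S_graph_part | split; [now apply S_graph_part | apply realize_parts]].
Qed.

Lemma InN_gaussian (f : R -> C) : InN f -> gaussian f.
Proof.
  intros H. destruct (InN_split f H) as [f0 [g0 [f1 [g1 [H0 [H1 ->]]]]]].
  apply gaussian_fadd; [apply (S_graph_gaussian _ _ _ H0) | apply (S_graph_gaussian _ _ _ H1)].
Qed.

(** From here on the form is computed from pairs of the graph, chosen at will; in particular
    [S_graph_hosc] provides those of [hosc f]. *)
Lemma that_eq (f0 g0 f1 g1 k0 l0 k1 l1 : R -> C) :
  S_graph false f0 g0 -> S_graph true f1 g1 -> S_graph false k0 l0 -> S_graph true k1 l1 ->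
  that (fadd f0 f1) (fadd k0 k1) =
  (1 / 2 * (ip g0 k0 + ip f0 l0) + 1 / 2 * (ip g1 k1 + ip f1 l1))%C.
Proof.
  intros H0 H1 K0 K1.
  assert (R : forall u0 v0 u1 v1, S_graph false u0 v0 -> S_graph true u1 v1 ->
    valid (rep (fadd u0 u1)) /\ realize (rep (fadd u0 u1)) = fadd u0 u1).
  { intros u0 v0 u1 v1 U0 U1.
    apply (epsilon_spec (inhabits nil) (fun F => valid F /\ realize F = fadd u0 u1)).
    apply InN_plus; [apply (S_graph_InN _ _ _ U0) | apply (S_graph_InN _ _ _ U1)]. }
  destruct (R _ _ _ _ H0 H1) as [VF EF]. destruct (R _ _ _ _ K0 K1) as [VK EK].
  destruct (formal_parts_unique _ _ _ _ _ VF H0 H1 EF) as [[A1 A2] [A3 A4]].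
  destruct (formal_parts_unique _ _ _ _ _ VK K0 K1 EK) as [[B1 B2] [B3 B4]].
  unfold part in *. unfold that, that_formal, t0_formal, t1_formal.
  rewrite A1, A2, A3, A4, B1, B2, B3, B4, RtoC_div by lra. reflexivity.
Qed.

Lemma fadd_fscal_parts (a : C) (f0 f1 g0 g1 : R -> C) :
  fadd (fadd f0 f1) (fscal a (fadd g0 g1)) = fadd (fadd f0 (fscal a g0)) (fadd f1 (fscal a g1)).
Proof. apply functional_extensionality; intros x. unfold fadd, fscal. ring. Qed.

Lemma that_sesquilinear : sesquilinear InN InN that.
Proof.
  split.
  - intros a f f' k Hf Hf' Hk.
    destruct (InN_split f Hf) as [f0 [g0 [f1 [g1 [H0 [H1 ->]]]]]].
    destruct (InN_split f' Hf') as [f0' [g0' [f1' [g1' [H0' [H1' ->]]]]]].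
    destruct (InN_split k Hk) as [k0 [l0 [k1 [l1 [K0 [K1 ->]]]]]].
    rewrite fadd_fscal_parts.
    rewrite (that_eq _ _ _ _ _ _ _ _ H0 H1 K0 K1), (that_eq _ _ _ _ _ _ _ _ H0' H1' K0 K1).
    rewrite (that_eq _ _ _ _ _ _ _ _ (S_graph_lin _ a _ _ _ _ H0 H0') (S_graph_lin _ a _ _ _ _ H1 H1') K0 K1).
    apply S_graph_gaussian in H0 as [? ?], H1 as [? ?], H0' as [? ?], H1' as [? ?], K0 as [? ?], K1 as [? ?].
    rewrite !ip_plus_l, !ip_scal_l by auto using gaussian_fscal. ring.
  - intros a k f f' Hk Hf Hf'.
    destruct (InN_split f Hf) as [f0 [g0 [f1 [g1 [H0 [H1 ->]]]]]].
    destruct (InN_split f' Hf') as [f0' [g0' [f1' [g1' [H0' [H1' ->]]]]]].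
    destruct (InN_split k Hk) as [k0 [l0 [k1 [l1 [K0 [K1 ->]]]]]].
    rewrite fadd_fscal_parts.
    rewrite (that_eq _ _ _ _ _ _ _ _ K0 K1 H0 H1), (that_eq _ _ _ _ _ _ _ _ K0 K1 H0' H1').
    rewrite (that_eq _ _ _ _ _ _ _ _ K0 K1 (S_graph_lin _ a _ _ _ _ H0 H0') (S_graph_lin _ a _ _ _ _ H1 H1')).
    apply S_graph_gaussian in H0 as [? ?], H1 as [? ?], H0' as [? ?], H1' as [? ?], K0 as [? ?], K1 as [? ?].
    rewrite !ip_plus_r, !ip_scal_r by auto using gaussian_fscal. ring.
Qed.

Lemma Cconj_half : Cconj (1 / 2) = (1 / 2)%C.
Proof. rewrite <- RtoC_div by lra. apply injective_projections; simpl; ring. Qed.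

Lemma that_symmetric (f k : R -> C) : InN f -> InN k -> Cconj (that f k) = that k f.
Proof.
  intros Hf Hk.
  destruct (InN_split f Hf) as [f0 [g0 [f1 [g1 [H0 [H1 ->]]]]]].
  destruct (InN_split k Hk) as [k0 [l0 [k1 [l1 [K0 [K1 ->]]]]]].
  rewrite (that_eq _ _ _ _ _ _ _ _ H0 H1 K0 K1), (that_eq _ _ _ _ _ _ _ _ K0 K1 H0 H1).
  apply S_graph_gaussian in H0 as [? ?], H1 as [? ?], K0 as [? ?], K1 as [? ?].
  rewrite !Cplus_conj, !Cmult_conj, !Cplus_conj, Cconj_half, !ip_conj by assumption. ring.
Qed.

Lemma S_graph_hosc_sum (f0 g0 f1 g1 : R -> C) :
  S_graph false f0 g0 -> S_graph true f1 g1 ->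
  hosc (fadd f0 f1) = fadd (hosc f0) (hosc f1).
Proof.
  intros H0 H1. apply S_graph_gaussian in H0 as [? _], H1 as [? _].
  replace (fadd f0 f1) with (fadd f0 (fscal 1 f1))
    by (apply functional_extensionality; intros x; unfold fadd, fscal; ring).
  rewrite hosc_lin by assumption.
  apply functional_extensionality; intros x; unfold fadd, fscal; ring.
Qed.

Lemma InN_hosc (f : R -> C) : InN f -> InN (hosc f).
Proof.
  intros Hf. destruct (InN_split f Hf) as [f0 [g0 [f1 [g1 [H0 [H1 ->]]]]]].
  rewrite (S_graph_hosc_sum _ _ _ _ H0 H1).
  apply InN_plus; eapply S_graph_InN, S_graph_hosc; eassumption.
Qed.

Lemma ip_even_odd (f0 g0 f1 g1 : R -> C) :
  S_graph false f0 g0 -> S_graph true f1 g1 -> ip f0 f1 = 0.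
Proof.
  intros H0 H1. apply ip_parity.
  - intros x. rewrite (S_graph_parity _ _ _ H0), (S_graph_parity _ _ _ H1), Cmult_1_l. ring.
  - apply (S_graph_gaussian _ _ _ H0).
  - apply (S_graph_gaussian _ _ _ H1).
Qed.

Lemma that_CCR (f k : R -> C) :
  InN f -> InN k -> (that (hosc f) k - Cconj (that (hosc k) f) = - Ci * ip f k)%C.
Proof.
  intros Hf Hk. rewrite that_symmetric by (try apply InN_hosc; assumption).
  destruct (InN_split f Hf) as [f0 [g0 [f1 [g1 [H0 [H1 ->]]]]]].
  destruct (InN_split k Hk) as [k0 [l0 [k1 [l1 [K0 [K1 ->]]]]]].
  rewrite (S_graph_hosc_sum _ _ _ _ H0 H1), (S_graph_hosc_sum _ _ _ _ K0 K1).
  rewrite (that_eq _ _ _ _ _ _ _ _ (S_graph_hosc _ _ _ H0) (S_graph_hosc _ _ _ H1) K0 K1).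
  rewrite (that_eq _ _ _ _ _ _ _ _ H0 H1 (S_graph_hosc _ _ _ K0) (S_graph_hosc _ _ _ K1)).
  assert (C1 := ip_even_odd _ _ _ _ H0 K1). assert (C2 := ip_even_odd _ _ _ _ K0 H1).
  apply S_graph_gaussian in H0 as [? ?], H1 as [? ?], K0 as [? ?], K1 as [? ?].
  assert (C3 : ip f1 k0 = 0).
  { rewrite <- ip_conj, C2 by assumption. apply injective_projections; simpl; ring. }
  (* With [hosc] moved to the right argument, all terms containing it cancel. In each parity the
     terms i f and i k contribute -i/2 times the inner product each, and the vanishing mixed
     products make the two parities add up to the inner product of the sums. *)
  rewrite !ip_plus_l, !ip_plus_r, !ip_scal_l, !ip_scal_r, !ip_hosc, C1, C3
    by auto using gaussian_fscal, gaussian_fadd, gaussian_hosc.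
  replace (Cconj Ci) with (- Ci)%C by (apply injective_projections; simpl; ring).
  field.
Qed.

Theorem theorem4p9 :
  (* S^ (and S^* ) are well defined by linear extension *)
  (forall F G : formal, valid F -> valid G -> realize F = realize G ->
     Sreal F = Sreal G) /\
  ultra_weak_time_operator D_hosc hosc InN InN that InN InN.
Proof.
  split; [exact Sreal_well_defined |].
  assert (HN : nonzero_subspace InN).
  { split; [split; [exact InN_zero | split; [exact InN_plus | exact InN_scal]] |].
    (* The Gaussian e^(-x^2), that is xi_z for z = 2i, an admissible point other than i; its value
       at 0 is not 0. *)
    exists (wave false 0 delta0 (2 * Ci)%C). split.
    - apply InN_wave. split; [simpl; lra |]. intros E. apply (f_equal Im) in E. simpl in E. lra.
    - intros E. apply (f_equal (fun h => h 0)) in E. unfold wave, fzero, xi in E. simpl in E.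
      rewrite !Cmult_1_l in E. now apply Cexp_neq_0 in E. }
  refine (conj HN (conj HN (conj that_sesquilinear (conj HN (conj HN
    (conj _ (conj _ (conj _ (conj that_symmetric (conj InN_hosc that_CCR)))))))))).
  - now split.
  - now split.
  - intros f Hf. split; [apply gaussian_D_hosc, InN_gaussian |]; exact Hf.
Qed.
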